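(* There exists an integer $N$ such that, for every integer $d\geq N$ and every non-negative real number $t$, $$ \Biggl|I_d(t)-\sqrt{\frac{6}{\pi}}\,e^{-6t^2}\biggl(1-\frac{3-72t^2+144t^4}{20d}\biggr)\Biggr|<\frac{1}{d^{3/2}}. $$
   Context: For a positive integer $d$ and a non-negative real number $t$, $I_d(t)$ denotes the $(d-1)$-dimensional volume of $H\cap[0,1]^d$ where $H$ is a hyperplane of $\mathbb{R}^d$ that is orthogonal to a diagonal of the hypercube $[0,1]^d$ (a segment joining two opposite vertices, for instance the one in direction $(1,\ldots,1)$) and whose Euclidean distance to the center of $[0,1]^d$ is equal to $t$. By symmetry, this does not depend on the choice of such an $H$. The volume is $0$ when the intersection is empty. *)

(* Defs.v *)
From HB Require Import structures.
From mathcomp Require Import all_boot all_order all_algebra.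
From mathcomp Require Import all_classical all_reals all_analysis.
From mathcomp Require Import measurable_realfun.
Set Implicit Arguments.
Unset Strict Implicit.
Unset Printing Implicit Defensive.
Import Order.TTheory GRing.Theory Num.Theory.
Import numFieldNormedType.Exports.
Local Open Scope classical_set_scope.
Local Open Scope ring_scope.

(* Lebesgue measure on the Borel sets of R^n, as the n-fold iterated product of
   the one-dimensional one. Only its values on Borel sets are meaningful. *)
Fixpoint lebesgue_tuple (R : realType) (n : nat) :
    set (n.-tuple (measurableTypeR R)) -> \bar R :=
  match n with
  | 0 => \d_([tuple] : 0.-tuple (measurableTypeR R))
  | m.+1 => pushforward
      (product_measure1 (@lebesgue_measure R) (@lebesgue_tuple R m))
      (fun p => [the m.+1.-tuple (measurableTypeR R) of p.1 :: p.2])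
  end.
Arguments lebesgue_tuple {R n}.

Definition lebesgue_rV (R : realType) (n : nat) (A : set 'rV[R]_n) : \bar R :=
  lebesgue_tuple [set t : n.-tuple (measurableTypeR R) | A (\row_i tnth t i)].

Lemma lebesgue_rV_box (R : realType) (n : nat) (a b : 'rV[R]_n) :
  (forall i, a 0 i <= b 0 i) ->
  lebesgue_rV [set x | forall i, a 0 i <= x 0 i <= b 0 i] =
  (\prod_i (b 0 i - a 0 i))%:E.
Proof.
elim: n a b => [|n IH] a b ab; rewrite /lebesgue_rV /=.
  by rewrite big_ord0 diracE mem_set//= => -[].
rewrite /pushforward /product_measure1 /=.
pose a' : 'rV[R]_n := \row_i a 0 (lift ord0 i).
pose b' : 'rV[R]_n := \row_i b 0 (lift ord0 i).
have := IH a' b'; rewrite /lebesgue_rV; set B := (X in lebesgue_tuple X).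
have -> : \prod_i (b' 0 i - a' 0 i) =
          \prod_(i < n) (b 0 (lift ord0 i) - a 0 (lift ord0 i)).
  by apply: eq_bigr => i _; rewrite !mxE.
move=> /(_ _)/wrap[|EB]; first by move=> i; rewrite !mxE.
transitivity (\int[@lebesgue_measure R]_x
   ((\1_(`[a 0 ord0, b 0 ord0]) x)%:E * lebesgue_tuple B))%E.
  apply: eq_integral => x _ /=.
  rewrite indicE; case: (boolP (x \in _)) => xab.
    rewrite mul1e; congr lebesgue_tuple; apply/seteqP; split => t /=.
      rewrite /xsection /= inE /= => + i => /(_ (lift ord0 i)).
      by rewrite !mxE tnthS.
    rewrite /xsection /= inE /= => Bt i.
    case: (unliftP ord0 i) => [j|] ->; rewrite !mxE ?tnthS ?tnth0.
      by have := Bt j; rewrite !mxE.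
    by move: xab; rewrite inE /= in_itv.
  rewrite mul0e (_ : xsection _ _ = set0); last first.
    apply/seteqP; split => t //=; rewrite /xsection /= inE /= => /(_ ord0).
    by rewrite mxE tnth0 => xab'; move/negP: xab; apply; rewrite inE /= in_itv.
  have : forall m, @lebesgue_tuple R m set0 = 0%E.
    elim=> [|m IHm]; first by rewrite /= diracE in_set0.
    rewrite /= /pushforward preimage_set0 /product_measure1.
    by rewrite integral0_eq// => y _ /=; rewrite xsection0.
  exact.
rewrite EB big_ord_recl /=.
rewrite ge0_integralZr//; last 2 first.
- by apply/measurable_EFinP; apply: measurable_indic.
- by rewrite lee_fin prodr_ge0// => i _; rewrite subr_ge0.
rewrite integral_indic//.
rewrite setIT [X in (X * _)%E](lebesgue_measure_itv `[a 0 ord0, b 0 ord0]) /=.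
rewrite lte_fin; case: ltgtP (ab ord0) => [h _|//|h _].
  by rewrite EFinM EFinB.
by rewrite h subrr mul0e mul0r.
Qed.

Section Euclidean.
Context {R : realType}.

Definition dotr (d : nat) (x y : 'rV[R]_d) : R := (x *m y^T) 0 0.

Definition eucl_norm (d : nat) (x : 'rV[R]_d) : R := Num.sqrt (dotr x x).

(* Euclidean distance from a point to a nonempty set *)
Definition eucl_dist (d : nat) (c : 'rV[R]_d) (S : set 'rV[R]_d) : R :=
  inf [set eucl_norm (x - c) | x in S].

(* k-dimensional volume of a subset S of a k-dimensional affine subspace of
   R^d: Lebesgue measure of S read in orthonormal coordinates of that subspace,
   with origin p and with the rows of M as basis. By rotation and translation
   invariance of Lebesgue measure the value does not depend on p and M. The
   value is 0 by convention if S lies in no such subspace. *)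
Definition flat_volume (k d : nat) (S : set 'rV[R]_d) : \bar R :=
  xget 0%E [set V | exists (p : 'rV[R]_d) (M : 'M[R]_(k, d)),
    [/\ M *m M^T = 1%:M,
        S `<=` range (fun u : 'rV[R]_k => p + u *m M) &
        V = lebesgue_rV [set u : 'rV[R]_k | S (p + u *m M)]]].

Definition cube (d : nat) : set 'rV[R]_d :=
  [set x | forall i, 0 <= x 0 i <= 1].

Definition cube_center (d : nat) : 'rV[R]_d := const_mx (2^-1).

Definition cube_vertex (d : nat) (p : 'rV[R]_d) : Prop :=
  forall i, p 0 i = 0 \/ p 0 i = 1.

Definition opposite_vertices (d : nat) (p q : 'rV[R]_d) : Prop :=
  [/\ cube_vertex p, cube_vertex q & forall i, p 0 i != q 0 i].

Definition hyperplane (d : nat) (a : 'rV[R]_d) (b : R) : set 'rV[R]_d :=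
  [set x | dotr a x = b].

Definition orthogonal_to_diagonal (d : nat) (H : set 'rV[R]_d) : Prop :=
  exists (p q : 'rV[R]_d) (b : R),
    opposite_vertices p q /\ H = hyperplane (q - p) b.

End Euclidean.

Arguments cube {R} d.
Arguments cube_center {R} d.

(* Main.v *)
Require Import Defs.
From HB Require Import structures.
From mathcomp Require Import all_boot all_order all_algebra.
From mathcomp Require Import all_classical all_reals all_analysis.
From mathcomp Require Import measurable_realfun ring lra.
Import Order.TTheory GRing.Theory Num.Theory.
Import numFieldNormedType.Exports.
Local Open Scope classical_set_scope.
Local Open Scope ring_scope.
Set Implicit Arguments.
Unset Strict Implicit.
Unset Printing Implicit Defensive.

(** Why the theorem holds. The section of the cube by a hyperplane orthogonal to a
    diagonal, at distance t from the centre, has volume sqrt d times the density at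
    t sqrt d of the sum of d independent uniform variables on [-1/2, 1/2]. The central
    limit theorem makes this density nearly Gaussian, and the statement is its
    second-order (Edgeworth) expansion with an error O(d^-2) that is uniform in t.

    Geometry. The volume of the section is defined through any orthonormal
    coordinates of any flat containing it. A section with relative interior determines the
    hyperplane (basis_chart); projecting it along one coordinate multiplies volume by
    1 / sqrt d and yields the slab of the (d-1)-dimensional cube on which the
    eliminated coordinate stays in [-1/2, 1/2] (chart_volume). The factor rests on
    the behaviour of the iterated Lebesgue measure under linear maps. This
    follows from one application of Tonelli's theorem (lebesgue_rV_mulmx), which
    shows that the scaling factor of a linear map can be computed on one well-chosen
    symmetric set: a ball for orthogonal maps, a cube for diagonal ones. The
    projection of the hyperplane is a product of such maps, thanks to a Householder
    reflection. Degenerate sections have volume 0, as does the slab.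

    Fourier inversion. Slicing shows that the slab volume in dimension n + 1 is the
    average of the one in dimension n over a unit window (slab_volumeS). On cosine
    transforms, averaging multiplies by sin x / x (cosint_average). Starting from
    the Poisson kernel, whose averages are differences of arctangents, and letting its
    width tend to 0 gives
      slab_volume n s = 2 / pi * integral over x > 0 of (sin x / x)^(n+1) cos (2 x s)
    for n >= 1 (slab_volume_cosint).

    Expansion. Taylor bounds give |(sin x / x)^d - exp (- d x^2 / 6) (1 - d x^4 / 180)|
    <= C d^-2 exp (- d x^2 / 32) + C d^-3 / (1 + x^2) for all x > 0
    (sinc_pow_gauss). The transform of the approximation is computed by
    differentiation under the integral sign and integration by parts (gauss_cos0,
    gauss_cos4), and is exactly the right-hand side of the theorem
    (cosint_corrected_gauss). Integrating the error bound leaves a constant times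
    d^-2, which is less than d^(-3/2) once d is large (section_volume_error). *)

(** * Lebesgue measure on row vectors *)

Section LebesgueTuple.
Context {R : realType}.
Notation T n := (n.-tuple (measurableTypeR R)).

(** Boxes exhaust the space and have finite measure, so any measure agreeing with
    the iterated one is sigma-finite; this is what allows Tonelli at the next
    dimension. *)
Lemma lebesgue_tuple_sigma_finite (n : nat) (mu : {measure set (T n) -> \bar R}) :
  @lebesgue_tuple R n = mu ->
  exists nu : {sigma_finite_measure set (T n) -> \bar R}, @lebesgue_tuple R n = nu.
Proof.
move=> Emu.
have sf : sigma_finite setT (mu : set (T n) -> \bar R).
  exists (fun k : nat => [set t : T n | forall i, - k%:R <= tnth t i <= k%:R]).
    apply/seteqP; split => // t _ /=.
    exists (Num.bound (\sum_i `|tnth t i|)) => // i.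
    have : `|tnth t i| <= \sum_i `|tnth t i|.
      by rewrite (bigD1 i)//= lerDl sumr_ge0.
    rewrite -ler_norml => /le_trans; apply.
    by apply/ltW/archi_boundP/sumr_ge0.
  move=> k; split.
    rewrite (_ : [set _ | _] =
        \bigcap_(i in [set: 'I_n]) ((@tnth n _ ^~ i) @^-1` `[- k%:R, k%:R])).
      apply: fin_bigcap_measurable => [|i _]; first exact: finite_finset.
      by rewrite -[X in measurable X]setTI; apply: measurable_tnth.
    apply/seteqP; split => t /= h i; last first.
      by have := h i Logic.I; rewrite /= in_itv.
    by move=> _; have := h i; rewrite /= in_itv.
  rewrite -Emu.
  have := @lebesgue_rV_box R n (const_mx (- k%:R)) (const_mx k%:R).
  rewrite /lebesgue_rV => /(_ _)/wrap[].
    by move=> i; rewrite !mxE (@le_trans _ _ 0)// ?oppr_le0 ler0n.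
  set A := (X in lebesgue_tuple X = _ -> _) => EA.
  rewrite (_ : [set _ | _] = A) ?EA ?ltry//.
  by apply/seteqP; split=> t /= h i; have := h i; rewrite !mxE.
have sff := sfinite_measure_sigma_finite sf.
case: mu Emu sf sff => mu0 c /= Emu sf sff.
pose m := HB.pack_for {sigma_finite_measure set (T n) -> \bar R} mu0
   (Measure.Pack c)
   (@isSFinite.Build _ (T n) R mu0 sff) (@isSigmaFinite.Build _ (T n) R mu0 sf).
by exists m; rewrite Emu.
Qed.

(** The iterated Lebesgue measure is given as a bare set function. Being an
    iterated product, it is a measure as soon as the measure one dimension below
    is sigma-finite, so both properties are carried through one induction. *)
Lemma lebesgue_tuple_measure (n : nat) :
  exists mu : {sigma_finite_measure set (T n) -> \bar R}, @lebesgue_tuple R n = mu.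
Proof.
elim: n => [|n [mu IH]].
  by exists (\d_([tuple] : 0.-tuple (measurableTypeR R))).
pose f (p : measurableTypeR R * T n) : T n.+1 := [the T n.+1 of p.1 :: p.2].
have mf : measurable_fun setT f.
  exact: measurable_cons.
pose m := @measure_function_pushforward__canonical__measure_function_Measure _ _ _ _ _
  (product_measure1 (@lebesgue_measure R) mu) _ mf.
apply: (@lebesgue_tuple_sigma_finite _ m).
by rewrite /= IH.
Qed.
End LebesgueTuple.

Section Translation.
Context {R : realType}.
Notation T n := (n.-tuple (measurableTypeR R)).
Notation leb := (@lebesgue_measure R).

(** A translate of Lebesgue measure gives the same value to every half-open
    interval, and those determine the measure. *)
Lemma lebesgue_measureDr (c : R) (A : set (measurableTypeR R)) :
  measurable A -> leb [set x | A (x + c)] = leb A.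
Proof.
pose f (x : measurableTypeR R) : measurableTypeR R := x + c.
have mf : measurable_fun setT f by apply: measurable_funD.
pose m := @measure_function_pushforward__canonical__measure_function_Measure _ _ _ _ _ leb _ mf.
move=> mA; transitivity (m A) => //.
symmetry; apply: lebesgue_measure_unique mA => X [[a b] _ <-].
rewrite /= /pushforward.
rewrite (_ : f @^-1` _ = `]a - c, b - c]%classic); last first.
  by apply/seteqP; split => x /=; rewrite /f !in_itv /= ltrBlDr lerBrDr.
rewrite !lebesgue_measure_itv /= !lte_fin ltrD2r.
by case: ifP => // _; rewrite -!EFinB; congr EFin; ring.
Qed.

Lemma ge0_integralDr (c : R) (g : measurableTypeR R -> \bar R) :
  measurable_fun setT g -> (forall x, 0 <= g x)%E ->
  (\int[leb]_x g (x + c)%R = \int[leb]_x g x)%E.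
Proof.
move=> mg g0.
pose f (x : measurableTypeR R) : measurableTypeR R := x + c.
have mf : measurable_fun setT f by apply: measurable_funD.
pose m := @measure_function_pushforward__canonical__measure_function_Measure _ _ _ _ _ leb _ mf.
transitivity (\int[m]_x g x)%E.
  by rewrite ge0_integral_pushforward.
apply: eq_measure_integral => A mA _.
exact: lebesgue_measureDr.
Qed.

Definition rv_of_tuple n (t : T n) : 'rV[R]_n := \row_i tnth t i.
(** Borel sets of row vectors, the sigma-algebra being the one carried by tuples. *)
Definition measurable_rV n (A : set 'rV[R]_n) :=
  measurable [set t : T n | A (rv_of_tuple t)].

Lemma measurable_preim_rV d (X : measurableType d) n (f : X -> 'rV[R]_n) (A : set 'rV[R]_n) :
  (forall i, measurable_fun setT (fun x => f x 0 i : measurableTypeR R)) ->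
  measurable_rV A -> measurable [set x | A (f x)].
Proof.
move=> mf mA; pose g x : T n := [tuple f x 0 i | i < n].
have mg : measurable_fun setT g.
  apply/measurable_fun_tnthP => i.
  rewrite (_ : _ \o _ = fun x => f x 0 i) //.
  by apply/funext => t /=; rewrite tnth_mktuple.
rewrite (_ : [set _ | _] = g @^-1` [set t : T n | A (rv_of_tuple t)]).
  by rewrite -[X in measurable X]setTI; exact: mg.
apply/seteqP; split => t /=; rewrite (_ : rv_of_tuple (g t) = f t) //;
  by apply/rowP => i; rewrite !mxE tnth_mktuple.
Qed.

Lemma rv_of_tuple_cons n (x : R) (t : T n) :
  rv_of_tuple [the T n.+1 of x :: t] = row_mx (\row_(_ < 1) x) (rv_of_tuple t).
Proof.
apply/rowP => i; rewrite !mxE.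
case: (@splitP 1 n i) => [j|j] /= ij; rewrite !mxE.
  by rewrite (_ : i = ord0) ?tnth0//; apply/val_inj; rewrite /= ij; case: j {ij} => -[].
by rewrite (_ : i = lift ord0 j) ?tnthS//; apply/val_inj; rewrite /= ij.
Qed.

(** Fubini slicing along the first coordinate, which the definition of the
    iterated measure makes true for every set. *)
Lemma lebesgue_rVS n (A : set 'rV[R]_n.+1) :
  lebesgue_rV A =
  (\int[leb]_x lebesgue_rV [set u : 'rV[R]_n | A (row_mx (\row_(_ < 1) x) u)])%E.
Proof.
rewrite /lebesgue_rV /= /pushforward /product_measure1.
apply: eq_integral => x _ /=; congr lebesgue_tuple.
by apply/seteqP; split => t /=; rewrite /xsection /= inE /= -rv_of_tuple_cons.
Qed.

Lemma measurable_rV_cons n (A : set 'rV[R]_n.+1) : measurable_rV A ->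
  measurable [set p : measurableTypeR R * T n | A (row_mx (\row_(_ < 1) p.1) (rv_of_tuple p.2))].
Proof.
move=> mA.
pose f (p : measurableTypeR R * T n) : T n.+1 := [the T n.+1 of p.1 :: p.2].
have mf : measurable_fun setT f by exact: measurable_cons.
rewrite (_ : [set _ | _] = f @^-1` [set t : T n.+1 | A (rv_of_tuple t)]).
  by rewrite -[X in measurable X]setTI; exact: mf.
by apply/seteqP; split => p /=; rewrite -rv_of_tuple_cons.
Qed.

Lemma measurable_fun_section n (A : set 'rV[R]_n.+1) : measurable_rV A ->
  measurable_fun setT (fun x : measurableTypeR R =>
    lebesgue_rV [set u : 'rV[R]_n | A (row_mx (\row_(_ < 1) x) u)]).
Proof.
move=> /measurable_rV_cons mA; rewrite /lebesgue_rV.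
have [mu ->] := @lebesgue_tuple_measure R n.
have := measurable_fun_xsection mu mA.
congr (measurable_fun _ _); apply/funext => x /=; congr (mu _).
by apply/seteqP; split => t /=; rewrite /xsection /= inE.
Qed.

Lemma lebesgue_rV_ge0 n (A : set 'rV[R]_n) : (0 <= lebesgue_rV A)%E.
Proof. by rewrite /lebesgue_rV; have [mu ->] := @lebesgue_tuple_measure R n. Qed.

Lemma measurable_rV_section n (A : set 'rV[R]_n.+1) x : measurable_rV A ->
  measurable_rV [set u : 'rV[R]_n | A (row_mx (\row_(_ < 1) x) u)].
Proof.
move=> /measurable_rV_cons/(measurable_xsection x).
by rewrite /measurable_rV; congr measurable; apply/seteqP; split => t /=; rewrite /xsection /= inE.
Qed.

(** Slicing reduces a translation to one in the first coordinate, absorbed by the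
    integral, and one in the remaining coordinates, handled by induction. *)
Lemma lebesgue_rVDr n (c : 'rV[R]_n) (A : set 'rV[R]_n) :
  measurable_rV A -> lebesgue_rV [set u | A (u + c)] = lebesgue_rV A.
Proof.
elim: n c A => [|n IH] c A mA.
  suff -> : [set u | A (u + c)] = A by [].
  by apply/seteqP; split => u /=; rewrite [u + c]thinmx0 [u]thinmx0.
rewrite !lebesgue_rVS -[RHS](ge0_integralDr (c 0 0)); last 2 first.
- exact: measurable_fun_section.
- by move=> x; exact: lebesgue_rV_ge0.
apply: eq_integral => x _.
rewrite -[RHS](IH (\row_i c 0 (lift ord0 i))); last exact: measurable_rV_section.
suff E u : row_mx (\row_(_ < 1) x) u + c =
    row_mx (\row_(_ < 1) (x + c 0 0)) (u + \row_i c 0 (lift ord0 i)) :> 'rV[R]_n.+1.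
  by congr (lebesgue_rV _); apply/seteqP; split => u /=; rewrite E.
apply/rowP => i; rewrite !mxE; case: (@splitP 1 n i) => [j|j] /= ij; rewrite !mxE.
  by congr (_ + c _ _); apply/val_inj; rewrite /= ij; case: j {ij} => -[].
by congr (_ + c _ _); apply/val_inj; rewrite /= ij.
Qed.
End Translation.

(** * Linear changes of variables *)

Section Linear.
Context {R : realType}.
Notation T n := (n.-tuple (measurableTypeR R)).

Lemma measurable_coord n (i : 'I_n) :
  measurable_fun setT (fun t : T n => rv_of_tuple t 0 i : measurableTypeR R).
Proof.
rewrite (_ : (fun _ => _) = @tnth n (measurableTypeR R) ^~ i); first exact: measurable_tnth.
by apply/funext => t; rewrite mxE.
Qed.

Lemma measurable_coord_mulmx d (X : measurableType d) m n (g : X -> T m)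
    (L : 'M[R]_(m, n)) (i : 'I_n) : measurable_fun setT g ->
  measurable_fun setT (fun t : X => (rv_of_tuple (g t) *m L) 0 i : measurableTypeR R).
Proof.
move=> mg; under eq_fun do rewrite mxE.
apply: measurable_sum => j; apply: measurable_funM => //.
by apply: (measurableT_comp (measurable_coord j) mg).
Qed.

(** How an invertible linear map scales volume does not depend on the set tested,
    provided one of the two sets is symmetric. Integrate the indicator of
    A(xL) and B(y + xL) over pairs (x, y): integrating y first gives the left-hand
    side by translation invariance. Integrating x first, the substitution
    x := x - y L^-1 turns the condition into A(xL - y) and B(xL); as A is symmetric,
    the former is A(y - xL), and integrating y first gives the right-hand side. Choosing A
    well then computes the scaling factor without any theory of determinants. *)
Lemma lebesgue_rV_mulmx n (L : 'M[R]_n) (A B : set 'rV[R]_n) :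
  L \in unitmx -> measurable_rV A -> measurable_rV B ->
  (forall u, A u -> A (- u)) ->
  (lebesgue_rV [set u | A (u *m L)] * lebesgue_rV B =
   lebesgue_rV [set u | B (u *m L)] * lebesgue_rV A)%E.
Proof.
move=> uL mA mB sA.
have symA u : A (- u) = A u.
  by apply/propext; split => /sA; rewrite ?opprK.
have mL C : measurable_rV C -> measurable [set t : T n | C (rv_of_tuple t *m L)].
  move=> mC; apply: (measurable_preim_rV _ mC) => i.
  by apply: (@measurable_coord_mulmx _ _ n n id) => //; exact: measurable_id.
have mD d (X : measurableType d) (f g : X -> 'rV[R]_n) C :
    (forall i, measurable_fun setT (fun x => f x 0 i : measurableTypeR R)) ->
    (forall i, measurable_fun setT (fun x => g x 0 i : measurableTypeR R)) ->
    measurable_rV C -> measurable [set x | C (f x + g x)].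
  move=> mf mg mC; apply: (measurable_preim_rV _ mC) => i.
  under eq_fun do rewrite mxE.
  by apply: measurable_funD; [exact: mf|exact: mg].
(* the pairs integrated, before and after the substitution *)
pose E1 := [set p : T n * T n | A (rv_of_tuple p.1 *m L) /\
  B (rv_of_tuple p.2 + rv_of_tuple p.1 *m L)].
pose E2 := [set p : T n * T n | A (rv_of_tuple p.2 + - (rv_of_tuple p.1 *m L)) /\
  B (rv_of_tuple p.1 *m L)].
have mfst i : measurable_fun setT
    (fun x : T n * T n => (rv_of_tuple x.1 *m L) 0 i : measurableTypeR R).
  by apply: (@measurable_coord_mulmx _ _ n n fst L i); exact: measurable_fst.
have msnd i : measurable_fun setT (fun x : T n * T n => rv_of_tuple x.2 0 i : measurableTypeR R).
  by apply: (measurableT_comp (measurable_coord i)); exact: measurable_snd.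
have mE1 : measurable E1.
  apply: measurableI; first exact: (measurable_preim_rV mfst mA).
  exact: (mD _ _ _ _ _ msnd mfst mB).
have mE2 : measurable E2.
  apply: measurableI; last exact: (measurable_preim_rV mfst mB).
  apply: (mD _ _ _ _ _ msnd _ mA) => i.
  under eq_fun do rewrite mxE.
  exact: measurable_funN (mfst i).
have [mu Emu] := @lebesgue_tuple_measure R n.
have HE C : lebesgue_rV C = mu [set t : T n | C (rv_of_tuple t)] by rewrite -Emu.
have shift (c : 'rV[R]_n) C : measurable_rV C ->
    mu [set t : T n | C (rv_of_tuple t + c)] = mu [set t : T n | C (rv_of_tuple t)].
  by move=> mC; rewrite -HE -(lebesgue_rVDr c) // HE.
have swap E : measurable E ->
    (\int[mu]_x mu (xsection E x) = \int[mu]_x mu (ysection E x))%E.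
  move=> mE; apply: (@product_measure_unique _ _ _ _ _ mu mu (mu \x^ mu)%E _ E mE).
  by move=> C D mC mD'; exact: product_measure2E.
have e1 : (\int[mu]_x mu (xsection E1 x) =
    lebesgue_rV [set u | A (u *m L)] * lebesgue_rV B)%E.
  transitivity (\int[mu]_x ((\1_[set t : T n | A (rv_of_tuple t *m L)] x)%:E * lebesgue_rV B))%E.
    apply: eq_integral => x _; rewrite indicE.
    have [Ax|Ax] := pselect (A (rv_of_tuple x *m L)); [rewrite mem_set//|rewrite memNset//].
      rewrite mul1e HE -(shift (rv_of_tuple x *m L)) //; congr (mu _).
      by apply/seteqP; split => t; rewrite /xsection /= inE /E1 /= => // -[].
    rewrite mul0e (_ : xsection _ _ = set0) ?measure0//.
    by apply/seteqP; split => t //; rewrite /xsection /= inE /E1 /= => -[].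
  rewrite ge0_integralZr//.
  - by rewrite integral_indic//; [rewrite setIT !HE|exact: (mL A mA)].
  - by apply/measurable_EFinP/measurable_indic; exact: (mL A mA).
  - exact: lebesgue_rV_ge0.
have -> : (lebesgue_rV [set u | A (u *m L)] * lebesgue_rV B = \int[mu]_x mu (ysection E1 x))%E.
  by rewrite -e1; exact: swap.
rewrite (_ : _ * _ = \int[mu]_x mu (xsection E2 x))%E; last first.
  transitivity (\int[mu]_x ((\1_[set t : T n | B (rv_of_tuple t *m L)] x)%:E * lebesgue_rV A))%E.
    rewrite ge0_integralZr//.
    - by rewrite integral_indic//; [rewrite setIT !HE|exact: (mL B mB)].
    - by apply/measurable_EFinP/measurable_indic; exact: (mL B mB).
    - exact: lebesgue_rV_ge0.
  apply: eq_integral => x _; rewrite indicE.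
  have [Bx|Bx] := pselect (B (rv_of_tuple x *m L)); [rewrite mem_set//|rewrite memNset//].
    rewrite mul1e HE -(shift (- (rv_of_tuple x *m L))) //; congr (mu _).
    by apply/seteqP; split => t; rewrite /xsection /= inE /E2 /= => // -[].
  rewrite mul0e (_ : xsection _ _ = set0) ?measure0//.
  by apply/seteqP; split => t //; rewrite /xsection /= inE /E2 /= => -[].
rewrite (swap _ mE2).
apply: eq_integral => y _.
pose C u := A (rv_of_tuple y + - (u *m L)) /\ B (u *m L).
have mC : measurable_rV C.
  by have := measurable_ysection y mE2; rewrite /measurable_rV; congr measurable;
    apply/seteqP; split => t; rewrite /ysection /= inE.
rewrite (_ : ysection E2 y = [set t | C (rv_of_tuple t)]); last first.
  by apply/seteqP; split => t; rewrite /ysection /= inE.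
rewrite -(shift (rv_of_tuple y *m invmx L)) //; congr (mu _).
apply/seteqP; split => t; rewrite /ysection /= inE /E1 /C /=.
  rewrite mulmxDl mulmxKV // opprD addrCA subrr addr0 symA addrC; done.
by rewrite mulmxDl mulmxKV // opprD addrCA subrr addr0 symA addrC.
Qed.
End Linear.

Section Orthogonal.
Context {R : realType}.
Notation T n := (n.-tuple (measurableTypeR R)).

Lemma mulIe_fin (a : R) (x y : \bar R) : a != 0 -> (x * a%:E = y * a%:E)%E -> x = y.
Proof.
move=> a0 h; have K z : (z * a%:E * (a^-1)%:E = z)%E.
  by rewrite -muleA -EFinM mulfV// mule1.
by rewrite -[x]K h K.
Qed.

Lemma le_lebesgue_rV n (A B : set 'rV[R]_n) :
  measurable_rV A -> measurable_rV B -> A `<=` B ->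
  (lebesgue_rV A <= lebesgue_rV B)%E.
Proof.
rewrite /lebesgue_rV; have [mu ->] := @lebesgue_tuple_measure R n.
by move=> mA mB AB; apply: le_measure; rewrite ?inE// => t; exact: AB.
Qed.

Lemma measurable_rV_box n (a b : 'rV[R]_n) :
  measurable_rV [set x | forall i, a 0 i <= x 0 i <= b 0 i].
Proof.
rewrite /measurable_rV.
rewrite (_ : [set _ | _] =
    \bigcap_(i in [set: 'I_n]) ((fun t : T n => rv_of_tuple t 0 i) @^-1` `[a 0 i, b 0 i])).
  apply: fin_bigcap_measurable => [|i _]; first exact: finite_finset.
  by rewrite -[X in measurable X]setTI; apply: measurable_coord.
by apply/seteqP; split => t /= h i; have := h i; rewrite /= in_itv//= => /(_ Logic.I).
Qed.

Lemma mulmx_trE n (u : 'rV[R]_n) : (u *m u^T) 0 0 = \sum_i u 0 i ^+ 2.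
Proof. by rewrite mxE; apply: eq_bigr => i _; rewrite mxE expr2. Qed.

Lemma measurable_rV_ball n (r : R) :
  measurable_rV [set u : 'rV[R]_n | (u *m u^T) 0 0 <= r].
Proof.
rewrite /measurable_rV.
rewrite (_ : [set _ | _] =
    (fun t : T n => \sum_j rv_of_tuple t 0 j ^+ 2) @^-1` `]-oo, r]).
  rewrite -[X in measurable X]setTI.
  have : measurable_fun setT
      (fun t : T n => \sum_j rv_of_tuple t 0 j ^+ 2 : measurableTypeR R).
    by apply: measurable_sum => j; apply: measurable_funX; exact: measurable_coord.
  by apply.
by apply/seteqP; split => t /=; rewrite in_itv /= mulmx_trE.
Qed.

(** The unit ball is symmetric, has positive finite volume, and is its own
    preimage under an orthogonal map: the scaling factor is 1. *)
Lemma lebesgue_rV_orthogonal n (Q : 'M[R]_n) (B : set 'rV[R]_n) :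
  Q *m Q^T = 1%:M -> measurable_rV B ->
  lebesgue_rV [set u | B (u *m Q)] = lebesgue_rV B.
Proof.
move=> QQ mB.
have uQ : Q \in unitmx by case: (mulmx1_unit QQ).
pose A := [set u : 'rV[R]_n | (u *m u^T) 0 0 <= 1].
have mA : measurable_rV A by exact: measurable_rV_ball.
have := @lebesgue_rV_mulmx R n Q A B uQ mA mB.
move=> /(_ _)/wrap[|].
  by move=> u; rewrite /A /= linearN /= mulNmx mulmxN opprK.
rewrite (_ : [set u | A (u *m Q)] = A); last first.
  by apply/seteqP; split => u; rewrite /A /= trmx_mul mulmxA -(mulmxA _ Q) QQ mulmx1.
have Afin : (lebesgue_rV A < +oo)%E.
  apply: le_lt_trans (ltry (\prod_(i < n) (1 - (- 1)))).
  have := @lebesgue_rV_box R n (const_mx (-1)) (const_mx 1).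
  under eq_bigr do rewrite !mxE.
  move=> /(_ _)/wrap[|<-]; first by move=> i; rewrite !mxE; lra.
  apply: le_lebesgue_rV => //; first exact: measurable_rV_box.
  move=> u; rewrite /A /= mulmx_trE => u1 i; rewrite !mxE -ler_norml.
  rewrite -(@ler_pXn2r _ 2)// ?nnegrE// real_normK ?num_real// expr1n.
  by apply: le_trans u1; rewrite (bigD1 i)//= lerDl sumr_ge0// => j _; exact: sqr_ge0.
have Apos : (0 < lebesgue_rV A)%E.
  (* a cube of side 2 / (n + 1) fits in the ball, as n / (n + 1)^2 <= 1 *)
  pose r : R := n.+1%:R^-1.
  have r0 : 0 < r by rewrite invr_gt0.
  apply: (@lt_le_trans _ _ (\prod_(i < n) (r - (- r)))%:E).
    by rewrite lte_fin; apply: prodr_gt0 => i _; rewrite opprK addr_gt0.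
  have := @lebesgue_rV_box R n (const_mx (-r)) (const_mx r).
  under eq_bigr do rewrite !mxE.
  move=> /(_ _)/wrap[|<-]; first by move=> i; rewrite !mxE (@le_trans _ _ 0)// ?oppr_le0 ltW.
  apply: le_lebesgue_rV => //; first exact: measurable_rV_box.
  move=> u /=; rewrite /A /= mulmx_trE => u1.
  apply: (@le_trans _ _ (\sum_(i < n) r)).
    apply: ler_sum => i _; have := u1 i; rewrite !mxE -ler_norml => h.
    rewrite -real_normK ?num_real// (@le_trans _ _ (r ^+ 2))//.
      by rewrite ler_pXn2r ?nnegrE// ltW.
    by rewrite expr2 ler_piMl ?(ltW r0)// /r invf_le1 ?ler1n.
  rewrite sumr_const card_ord -mulr_natl /r ler_pdivrMr// mul1r ler_nat//.
have Afn : lebesgue_rV A \is a fin_num by rewrite ge0_fin_numE // ltW.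
move: Apos; rewrite -(fineK Afn) lte_fin => Apos.
rewrite [in LHS]muleC => h.
by apply/esym; apply: (mulIe_fin _ h); rewrite gt_eqF.
Qed.

(** Here the test set is the cube with vertices -1 and 1, whose preimage is a box. *)
Lemma lebesgue_rV_diag n (v : 'rV[R]_n) (B : set 'rV[R]_n) :
  (forall i, 0 < v 0 i) -> measurable_rV B ->
  (lebesgue_rV [set u | B (u *m diag_mx v)] = (\prod_i (v 0 i)^-1)%:E * lebesgue_rV B)%E.
Proof.
move=> v0 mB.
have uQ : diag_mx v \in unitmx.
  rewrite unitmxE det_diag unitfE; apply/prodf_neq0 => i _; by rewrite gt_eqF.
pose A := [set u : 'rV[R]_n | forall i,
  (const_mx (-1) : 'rV[R]_n) 0 i <= u 0 i <= (const_mx 1 : 'rV[R]_n) 0 i].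
have mA : measurable_rV A by exact: measurable_rV_box.
have := @lebesgue_rV_mulmx R n _ A B uQ mA mB.
move=> /(_ _)/wrap[|].
  by move=> u /= h i; have := h i; rewrite !mxE lerNr opprK lerNl andbC.
have EA : lebesgue_rV A = (\prod_(i < n) 2)%:E.
  rewrite lebesgue_rV_box.
    by congr EFin; apply: eq_bigr => i _; rewrite !mxE opprK.
  by move=> i; rewrite !mxE; lra.
have -> : lebesgue_rV [set u | A (u *m diag_mx v)] = (\prod_(i < n) (2 / v 0 i))%:E.
  rewrite (_ : [set _ | _] = [set u : 'rV[R]_n | forall i,
    (\row_j - (v 0 j)^-1) 0 i <= u 0 i <= (\row_j (v 0 j)^-1) 0 i]).
    rewrite lebesgue_rV_box.
      by congr EFin; apply: eq_bigr => i _; rewrite !mxE opprK mulr2n mulrDl mul1r.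
    by move=> i; rewrite !mxE (@le_trans _ _ 0)// ?oppr_le0 invr_ge0 ltW.
  have e (a b : R) : 0 < b -> (-1 <= a * b <= 1) = (- b^-1 <= a <= b^-1).
    by move=> b0; rewrite -[in RHS]mulN1r -[X in _ = (_ <= _ <= X)]mul1r ler_pdivrMr// ler_pdivlMr.
  by apply/seteqP; split => u /= h i; have := h i; rewrite mul_mx_diag !mxE e.
rewrite EA big_split /= EFinM -muleA [in LHS]muleC => h.
have p0 : 0 < \prod_(i < n) (2 : R) by apply: prodr_gt0.
apply/esym.
by apply: (mulIe_fin _ h); rewrite gt_eqF.
Qed.
End Orthogonal.

Section Gram.
Context {R : realType}.

Let ones n : 'cV[R]_n := const_mx 1.

(** The Householder reflection exchanging the all-ones vector and the multiple of
    the first basis vector of the same length. In dimension 1 the two coincide, and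
    the convention that 0 has inverse 0 makes the formula give the identity. *)
Lemma reflection_ones (m : nat) : exists O : 'M[R]_m.+1,
  [/\ O^T = O, O *m O = 1%:M &
      O *m ones m.+1 = Num.sqrt m.+1%:R *: delta_mx 0 0].
Proof.
set n := m.+1; pose q : R := Num.sqrt n%:R.
have qq : q * q = n%:R by rewrite -expr2 sqr_sqrtr.
pose a : 'cV[R]_n := ones n - q *: delta_mx 0 0.
have aE i : a i 0 = 1 - q * (i == 0)%:R by rewrite !mxE andbT.
have sum0 (x : R) : \sum_(i < n) x * (i == 0)%:R = x.
  rewrite (bigD1 0)//= mulr1 big1 ?addr0// => i /negbTE ->; exact: mulr0.
pose p : R := n%:R - q.
have a1 : a^T *m ones n = p%:M.
  rewrite [LHS]mx11_scalar; congr _%:M; rewrite mxE.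
  under eq_bigr do rewrite [a^T _ _]mxE aE mxE mulr1.
  by rewrite big_split /= sumr_const card_ord -[1 *+ n]/(n%:R) sumrN sum0.
have aa : a^T *m a = (2 * p)%:M.
  rewrite [LHS]mx11_scalar; congr _%:M; rewrite mxE.
  rewrite (eq_bigr (fun i => (1 + (n%:R - 2 * q) * (i == 0)%:R))); last first.
    move=> i _; rewrite [a^T _ _]mxE aE -qq; case: (i == 0) => /=; ring.
  rewrite big_split /= sumr_const card_ord -[1 *+ n]/(n%:R) sum0 /p; ring.
have pa : p = 0 -> a = 0.
  move=> p0; have : \sum_(i < n) (a i 0) ^+ 2 = 0.
    move: aa => /matrixP/(_ 0 0); rewrite p0 mulr0 mxE [RHS]mxE mul0rn => E; rewrite -[RHS]E.
    by apply: eq_bigr => i _; rewrite expr2 [a^T _ _]mxE.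
  move/eqP; rewrite psumr_eq0; last by move=> i _; exact: sqr_ge0.
  move/allP => h; apply/matrixP => i j; rewrite ord1 [RHS]mxE; apply/eqP.
  by rewrite -[_ == 0](@expf_eq0 _ _ 2) /=; apply: (h i); rewrite mem_index_enum.
(* the factor 2 / (a^T a) of the reflection along a is 1 / p *)
exists (1%:M - p^-1 *: (a *m a^T)); split.
- by rewrite linearB /= tr_scalar_mx linearZ /= trmx_mul trmxK.
- rewrite mulmxBl !mulmxBr !mul1mx mulmx1 -scalemxAl -scalemxAr scalerA.
  rewrite mulmxA -(mulmxA a a^T a) aa mul_mx_scalar -scalemxAl scalerA.
  have [p0|p0] := eqVneq p 0; first by rewrite (pa p0) !mul0mx !scaler0 !subr0.
  rewrite (_ : p^-1 * p^-1 * (2 * p) = p^-1 + p^-1); last by field.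
  by rewrite scalerDl; set B := p^-1 *: _; rewrite opprB addrK subrK.
- rewrite mulmxBl mul1mx -scalemxAl -mulmxA a1 mul_mx_scalar scalerA.
  have [p0|p0] := eqVneq p 0.
    by rewrite p0 invr0 mul0r scale0r subr0; apply/eqP; rewrite -subr_eq0; apply/eqP/pa.
  by rewrite mulVf// scale1r /a opprB addrC subrK.
Qed.

Let weights m : 'rV[R]_m.+1 := \row_i (if i == 0 then m.+2%:R else 1).

Let weights_gt0 m i : 0 < weights m 0 i.
Proof. by rewrite mxE; case: ifP. Qed.

Let inv_sqrt_weights m : 'rV[R]_m.+1 := \row_i (Num.sqrt (weights m 0 i))^-1.

(** The reflection turns 1 + e e^T, with e the all-ones vector, into a diagonal
    matrix with a single entry different from 1. *)
Lemma gram_ones_diag (m : nat) : exists P : 'M[R]_m.+1,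
  [/\ P^T = P, P *m P = 1%:M &
      P *m (1%:M + ones m.+1 *m (ones m.+1)^T) *m P = diag_mx (weights m)].
Proof.
have [P [OT OO Oe]] := reflection_ones m; exists P; split => //.
rewrite mulmxDr mulmxDl mulmx1 OO mulmxA -(mulmxA _ _ P) -{2}OT -trmx_mul Oe.
rewrite linearZ /= -scalemxAl -scalemxAr scalerA -expr2 sqr_sqrtr //.
rewrite trmx_delta mul_delta_mx; apply/matrixP => i j; rewrite !mxE.
have [->|ij] := eqVneq i j; last first.
  case: (i =P 0) => [i0|] /=; last by rewrite mulr0 addr0.
  by move: ij; rewrite i0 eq_sym => /negbTE ->; rewrite mulr0 addr0.
rewrite andbb mulr1n; case: ifP => _ /=; last by rewrite mulr0 addr0.
by rewrite mulr1 -[m.+2]add1n natrD.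
Qed.

(** Write e for the all-ones vector. The rows of [-e | I] form a basis of the
    hyperplane orthogonal to the diagonal, with Gram matrix 1 + e e^T, so K
    is a change from an orthonormal basis to this one. Writing
    1 + e e^T = P w P with P orthogonal and w diagonal, K is the product of an
    orthogonal matrix, the diagonal matrix of the 1 / sqrt w_i and P, so it scales volume
    by the product of the sqrt w_i, which is the square root of the dimension of
    the ambient space. *)
Lemma lebesgue_rV_hyperplane_chart (m : nat) (K : 'M[R]_m.+1) (B : set 'rV[R]_m.+1) :
  K *m (1%:M + ones m.+1 *m (ones m.+1)^T) *m K^T = 1%:M ->
  measurable_rV B ->
  (lebesgue_rV [set u | B (u *m K)] = (Num.sqrt m.+2%:R)%:E * lebesgue_rV B)%E.
Proof.
move=> KK mB; have [P [OT OO Ow]] := gram_ones_diag m.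
set w := weights m in Ow *; pose v := inv_sqrt_weights m.
have w0 i : 0 < w 0 i by exact: weights_gt0.
have v0 i : 0 < v 0 i by rewrite mxE invr_gt0 sqrtr_gt0.
pose v' : 'rV[R]_m.+1 := \row_i (Num.sqrt (w 0 i)).
have vv' : diag_mx v' *m diag_mx v = 1%:M.
  rewrite mulmx_diag -diag_const_mx; congr diag_mx; apply/rowP => i.
  by rewrite !mxE mulfV// gt_eqF ?sqrtr_gt0//; have := w0 i; rewrite mxE.
have v'v' : diag_mx v' *m diag_mx v' = diag_mx w.
  rewrite mulmx_diag; congr diag_mx; apply/rowP => i.
  by rewrite mxE [v' _ _]mxE -expr2 sqr_sqrtr// ltW.
pose Q := K *m P *m diag_mx v'.
have QQ : Q *m Q^T = 1%:M.
  have wP : P *m diag_mx w *m P = 1%:M + ones m.+1 *m (ones m.+1)^T.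
    by rewrite -Ow !mulmxA OO mul1mx -mulmxA OO mulmx1.
  rewrite -KK -wP /Q !trmx_mul tr_diag_mx OT !mulmxA.
  by rewrite -(mulmxA _ (diag_mx v')) v'v'.
have KE : K = Q *m (diag_mx v *m P).
  by rewrite /Q mulmxA -(mulmxA _ (diag_mx v')) vv' mulmx1 -mulmxA OO mulmx1.
have mm (M : 'M[R]_m.+1) (C : set 'rV[R]_m.+1) :
    measurable_rV C -> measurable_rV [set u | C (u *m M)].
  move=> mC; apply: (measurable_preim_rV _ mC) => i.
  by apply: (@measurable_coord_mulmx _ _ _ m.+1 m.+1 id) => //; exact: measurable_id.
transitivity (lebesgue_rV [set u | [set x | [set y | B (y *m P)] (x *m diag_mx v)] (u *m Q)]).
  by congr lebesgue_rV; apply/seteqP; split => u /=; rewrite KE !mulmxA.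
rewrite lebesgue_rV_orthogonal //; last by exact: (mm _ _ (mm _ _ mB)).
rewrite lebesgue_rV_diag//; last exact: (mm _ _ mB).
rewrite lebesgue_rV_orthogonal //; last by rewrite OT.
congr (_%:E * _)%E; rewrite (bigD1 0)//= big1; last first.
  by move=> i /negbTE i0; rewrite !mxE i0 sqrtr1 !invr1.
by rewrite !mxE eqxx invrK mulr1.
Qed.
(** An orthonormal basis of the hyperplane exists: take w^(-1/2) P. *)
Lemma exists_hyperplane_chart (m : nat) : exists K : 'M[R]_m.+1,
  K *m (1%:M + ones m.+1 *m (ones m.+1)^T) *m K^T = 1%:M.
Proof.
have [P [PT _ Pw]] := gram_ones_diag m.
exists (diag_mx (inv_sqrt_weights m) *m P).
rewrite trmx_mul PT tr_diag_mx !mulmxA -(mulmxA _ P (1%:M + _)) -(mulmxA _ _ P) Pw.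
rewrite !mulmx_diag -diag_const_mx; congr diag_mx; apply/rowP => i.
rewrite ![in LHS]mxE; have := weights_gt0 i; rewrite mxE => w0.
rewrite mxE mulrAC -invfM -expr2 sqr_sqrtr; last exact: ltW.
by rewrite mulVf // lt0r_neq0.
Qed.
End Gram.

(** * Slabs of the centred cube *)

Section Slab.
Context {R : realType}.
Notation T n := (n.-tuple (measurableTypeR R)).
Notation leb := (@lebesgue_measure R).

(** The points of the centred unit cube whose coordinate sum is within 1/2 of s.
    Its volume is also the density at s of the sum of n + 1 independent uniform
    variables on [-1/2, 1/2]: one coordinate of the cube section is eliminated. *)
Definition central_slab n (s : R) : set 'rV[R]_n :=
  [set z | (forall i, `|z 0 i| <= 2^-1) /\ `|s - \sum_i z 0 i| <= 2^-1].

Arguments central_slab : clear implicits.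

Definition slab_volume n (s : R) : R := fine (lebesgue_rV (central_slab n s)).

Lemma measurable_central_slab n s : measurable_rV (central_slab n s).
Proof.
rewrite /measurable_rV.
rewrite (_ : [set _ | _] =
    (\bigcap_(i in [set: 'I_n]) ((fun t : T n => rv_of_tuple t 0 i) @^-1` `[- 2^-1, 2^-1])) `&`
    ((fun t : T n => s - \sum_j rv_of_tuple t 0 j) @^-1` `[- 2^-1, 2^-1])).
  apply: measurableI.
    apply: fin_bigcap_measurable => [|i _]; first exact: finite_finset.
    by rewrite -[X in measurable X]setTI; apply: measurable_coord.
  rewrite -[X in measurable X]setTI.
  have : measurable_fun setT
      (fun t : T n => s - \sum_j rv_of_tuple t 0 j : measurableTypeR R).
    apply: measurable_funB => //.
    by apply: measurable_sum => j; exact: measurable_coord.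
  by apply.
apply/seteqP; split => t /=; rewrite in_itv /= -ler_norml => -[h ?]; split => // i.
  by move=> _; rewrite /= in_itv /= -ler_norml.
by have := h i Logic.I; rewrite /= in_itv /= -ler_norml.
Qed.

Lemma slab_volumeE n s : lebesgue_rV (central_slab n s) = (slab_volume n s)%:E.
Proof.
rewrite fineK// ge0_fin_numE ?lebesgue_rV_ge0//.
apply: le_lt_trans (ltry (\prod_(i < n) (2^-1 - - 2^-1))).
have := @lebesgue_rV_box R n (const_mx (- 2^-1)) (const_mx (2^-1)).
under eq_bigr do rewrite !mxE.
move=> /(_ _)/wrap[|<-]; first by move=> i; rewrite !mxE; lra.
apply: le_lebesgue_rV; [exact: measurable_central_slab|exact: measurable_rV_box|].
by move=> u [/= h _] i; rewrite !mxE -ler_norml.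
Qed.

Lemma slab_volume_ge0 n s : 0 <= slab_volume n s.
Proof. by rewrite -lee_fin -slab_volumeE lebesgue_rV_ge0. Qed.

Lemma slab_volume_le1 n s : slab_volume n s <= 1.
Proof.
rewrite -lee_fin -slab_volumeE.
apply: (@le_trans _ _ (\prod_(i < n) (2^-1 - - 2^-1))%:E); last first.
  by rewrite lee_fin big1// => i _; lra.
have := @lebesgue_rV_box R n (const_mx (- 2^-1)) (const_mx (2^-1)).
under eq_bigr do rewrite !mxE.
move=> /(_ _)/wrap[|<-]; first by move=> i; rewrite !mxE; lra.
apply: le_lebesgue_rV; [exact: measurable_central_slab|exact: measurable_rV_box|].
by move=> u [/= h _] i; rewrite !mxE -ler_norml.
Qed.

Lemma slab_volume0 s : slab_volume 0 s = if `|s| <= 2^-1 then 1 else 0.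
Proof.
apply: EFin_inj; rewrite -slab_volumeE /lebesgue_rV /= diracE.
case: ifPn => hs.
  by rewrite mem_set// /central_slab /=; split=> [[]//|]; rewrite big_ord0 subr0.
by rewrite memNset// /central_slab /= big_ord0 subr0 => -[_]; exact/negP.
Qed.

Lemma measurable_slab_volume n : measurable_fun setT (slab_volume n : measurableTypeR R -> R).
Proof.
pose E := [set p : measurableTypeR R * T n | central_slab n p.1 (rv_of_tuple p.2)].
have mE : measurable E.
  have mi i : measurable_fun setT
      (fun p : measurableTypeR R * T n => rv_of_tuple p.2 0 i : measurableTypeR R).
    by apply: (measurableT_comp (measurable_coord i)); exact: measurable_snd.
  rewrite (_ : E =
      (\bigcap_(i in [set: 'I_n])
        ((fun t : measurableTypeR R * T n => rv_of_tuple t.2 0 i) @^-1`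
          `[- 2^-1, 2^-1])) `&`
      ((fun t : measurableTypeR R * T n => t.1 - \sum_j rv_of_tuple t.2 0 j) @^-1`
        `[- 2^-1, 2^-1])).
    apply: measurableI.
      apply: fin_bigcap_measurable => [|i _]; first exact: finite_finset.
      by rewrite -[X in measurable X]setTI; apply: mi.
    rewrite -[X in measurable X]setTI.
    have : measurable_fun setT
        (fun t : measurableTypeR R * T n => t.1 - \sum_j rv_of_tuple t.2 0 j : measurableTypeR R).
      apply: measurable_funB; first exact: measurable_fst.
      by apply: measurable_sum => j; exact: mi.
    by apply.
  apply/seteqP; split => t /=; rewrite in_itv /= -ler_norml => -[h ?]; split => // i.
    by move=> _; rewrite /= in_itv /= -ler_norml.
  by have := h i Logic.I; rewrite /= in_itv /= -ler_norml.
have [mu Emu] := @lebesgue_tuple_measure R n.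
have := measurable_fun_xsection mu mE.
have -> : mu \o xsection E = EFin \o slab_volume n.
  apply/funext => x /=; rewrite -slab_volumeE /lebesgue_rV Emu; congr (mu _).
  by apply/seteqP; split => t /=; rewrite /xsection /= inE.
by move/measurable_EFinP.
Qed.

Lemma measurable_slab_volumeB n s (D : set (measurableTypeR R)) :
  measurable_fun D (fun x => slab_volume n (s - x)).
Proof.
apply/measurable_funTS/(measurableT_comp (@measurable_slab_volume n)).
exact: measurable_funB.
Qed.

Lemma lebesgue_rV0 n : lebesgue_rV (set0 : set 'rV[R]_n) = 0%E.
Proof.
by rewrite /lebesgue_rV; have [mu ->] := @lebesgue_tuple_measure R n; exact: measure0.
Qed.

(** One more uniform variable amounts to averaging over a unit window. *)
Lemma slab_volumeS n s :
  slab_volume n.+1 s = \int[leb]_(x in `[- 2^-1, 2^-1]) slab_volume n (s - x).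
Proof.
apply: EFin_inj; rewrite -slab_volumeE lebesgue_rVS.
transitivity (\int[leb]_(x in `[(- 2^-1)%R, (2^-1)%R]) (slab_volume n (s - x))%:E)%E.
  rewrite [RHS]integral_mkcond; apply: eq_integral => x _ /=; rewrite patchE.
  have E u : central_slab n.+1 s (row_mx (\row_(_ < 1) x) u) <->
     `|x| <= 2^-1 /\ central_slab n (s - x) u.
    have S : \sum_i row_mx (\row_(_ < 1) x) u 0 i = x + \sum_i u 0 i.
      rewrite (@big_split_ord _ _ _ 1 n) big_ord1 row_mxEl mxE.
      by congr (_ + _); apply: eq_bigr => i _; rewrite row_mxEr.
    rewrite /central_slab /= S opprD addrA; split => [[h1 h2]|[h1 [h2 h3]]].
      split; last split => //.
        by have := h1 (@lshift 1 n ord0); rewrite (@row_mxEl _ 1 1 n) mxE.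
      by move=> i; have := h1 (@rshift 1 n i); rewrite (@row_mxEr _ 1 1 n).
    split => // i; case: (@splitP 1 n i) => j ij.
      by rewrite (_ : i = @lshift 1 n j) ?(@row_mxEl _ 1 1 n) ?mxE//; exact/val_inj.
    by rewrite (_ : i = @rshift 1 n j) ?(@row_mxEr _ 1 1 n)//; exact/val_inj.
  case: ifPn; rewrite ?notin_setE ?inE /= in_itv /= -ler_norml => xh.
    rewrite -slab_volumeE; congr lebesgue_rV; apply/seteqP; split => u /=.
      by rewrite E => -[].
    by rewrite E.
  rewrite (_ : [set _ | _] = set0); first exact: lebesgue_rV0.
  by apply/seteqP; split => u //=; rewrite E => -[].
rewrite /Rintegral fineK// ge0_fin_numE; last first.
  by apply: integral_ge0 => x _; rewrite lee_fin slab_volume_ge0.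
apply: (@le_lt_trans _ _ (\int[leb]_(x in `[(- 2^-1)%R, (2^-1)%R]) 1)%E); last first.
  rewrite integral_cst//= mul1e lebesgue_measure_itv /= lte_fin.
  by case: ifP => _; rewrite ltry.
apply: ge0_le_integral => //.
- by move=> x _; rewrite lee_fin slab_volume_ge0.
- by apply/measurable_EFinP; exact: measurable_slab_volumeB.
- by move=> x _; rewrite lee_fin slab_volume_le1.
Qed.

Lemma lebesgue_rV_subsingleton n (A : set 'rV[R]_n.+1) (a : 'rV[R]_n.+1) :
  A `<=` [set a] -> lebesgue_rV A = 0%E.
Proof.
move=> Aa.
have a0 : lebesgue_rV [set a] = 0%E.
  rewrite (_ : [set a] = [set x | forall i, a 0 i <= x 0 i <= a 0 i]).
    by rewrite lebesgue_rV_box// (bigD1 ord0)//= subrr mul0r.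
  apply/seteqP; split => x /=; first by move=> -> i; rewrite lexx.
  by move=> h; apply/rowP => i; apply/eqP; rewrite eq_le andbC.
by have [->|->//] := subset_set1 Aa; exact: lebesgue_rV0.
Qed.
End Slab.
Arguments central_slab {R} n s.

(** * Sections of the cube by hyperplanes orthogonal to a diagonal *)

Section FlatVolume.
Context {R : realType}.

Lemma eq_const_half k (z : 'rV[R]_k) : (forall i, `|z 0 i| <= 2^-1) ->
  k%:R / 2 <= \sum_i z 0 i -> z = const_mx 2^-1.
Proof.
move=> zh zs; have z0 i : 0 <= 2^-1 - z 0 i.
  by rewrite subr_ge0 (le_trans (ler_norm _)).
have : \sum_i (2^-1 - z 0 i) = 0.
  apply/eqP; rewrite eq_le sumr_ge0// andbT.
  by rewrite big_split /= sumrN sumr_const card_ord subr_le0 -(mulr_natl (2^-1)).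
move/eqP; rewrite psumr_eq0// => /allP h.
apply/rowP => i; rewrite mxE; apply/esym/eqP; rewrite -subr_eq0.
by apply: (h i); rewrite mem_index_enum.
Qed.

(** The section of the centred cube by a hyperplane orthogonal to its main
    diagonal, s being the coordinate sum on the hyperplane. *)
Definition central_section d (s : R) : set 'rV[R]_d :=
  [set z | (forall i, `|z 0 i| <= 2^-1) /\ \sum_i z 0 i = s].
Arguments central_section : clear implicits.

Variable m : nat.
Let n := m.+1.
Let ones : 'cV[R]_n := const_mx 1.
Let J : 'M[R]_(n, 1 + n) := row_mx (- ones) 1%:M.
Let P : 'M[R]_(1 + n, n) := col_mx 0 1%:M.

Let JP : J *m P = 1%:M.
Proof. by rewrite mul_row_col mulmx0 add0r mulmx1. Qed.

Let JJ : J *m J^T = 1%:M + ones *m ones^T.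
Proof.
by rewrite tr_row_mx mul_row_col linearN /= mulmxN mulNmx opprK trmx1 mulmx1 addrC.
Qed.

Let J0 (y : 'rV[R]_n) : (y *m J) 0 (@lshift 1 n 0) = - \sum_i y 0 i.
Proof.
rewrite mul_mx_row row_mxEl mxE -sumrN; apply: eq_bigr => i _.
by rewrite !mxE mulrN1.
Qed.

Let JS (y : 'rV[R]_n) i : (y *m J) 0 (@rshift 1 n i) = y 0 i.
Proof. by rewrite mul_mx_row row_mxEr mulmx1. Qed.

Let sumE (z : 'rV[R]_n.+1) : \sum_i z 0 i = z 0 (@lshift 1 n 0) + \sum_i z 0 (@rshift 1 n i).
Proof. by rewrite (@big_split_ord _ _ _ 1 n) big_ord1. Qed.

Let allE (Q : 'I_n.+1 -> Prop) :
  (forall i, Q i) <-> Q (@lshift 1 n 0) /\ forall i, Q (@rshift 1 n i).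
Proof.
split=> [h|[h1 h2] i]; first by split=> *; exact: h.
case: (@splitP 1 n i) => j ij.
  by rewrite (_ : i = @lshift 1 n 0)//; apply/val_inj; rewrite /= ij; case: j {ij} => -[].
by rewrite (_ : i = @rshift 1 n j)//; exact/val_inj.
Qed.

Lemma slab_volumeN k (s : R) : slab_volume k (- s) = slab_volume k s.
Proof.
rewrite /slab_volume; congr fine.
rewrite -[RHS](@lebesgue_rV_orthogonal _ _ (- 1%:M)); last first.
- exact: measurable_central_slab.
- by rewrite linearN /= trmx1 mulNmx mulmxN opprK mulmx1.
have zE z i : (z *m - 1%:M : 'rV[R]_k) 0 i = - z 0 i by rewrite mulmxN mulmx1 mxE.
have SE (z : 'rV[R]_k) : \sum_i (z *m - 1%:M) 0 i = - \sum_i z 0 i.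
  by rewrite -sumrN; apply: eq_bigr => i _; rewrite zE.
congr lebesgue_rV; apply/seteqP; split => z /= [h1 h2]; split.
- by move=> i; rewrite zE normrN.
- by move: h2; rewrite SE -normrN opprD !opprK.
- by move=> i; have := h1 i; rewrite zE normrN.
- by move: h2; rewrite SE -normrN opprD !opprK.
Qed.

Let slab_volume_far_pos (s : R) : n.+1%:R / 2 <= s -> slab_volume n s = 0.
Proof.
move=> hs; apply: EFin_inj; rewrite -slab_volumeE.
apply: (@lebesgue_rV_subsingleton _ _ _ (const_mx 2^-1)) => z [zh zs].
apply: eq_const_half => //; move: zs hs; rewrite ler_norml => /andP[_].
by rewrite -natr1 -/n; lra.
Qed.

Lemma slab_volume_far (s : R) : n.+1%:R / 2 <= `|s| -> slab_volume n s = 0.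
Proof.
have [s0|s0] := leP 0 s; first by rewrite ger0_norm//; exact: slab_volume_far_pos.
by rewrite ltr0_norm// => h; rewrite -slab_volumeN slab_volume_far_pos.
Qed.

(** Beyond the corners the section is empty or a single vertex, so its volume
    vanishes whatever orthonormal coordinates are used, even though these are then
    not determined by the section. *)
Lemma chart_far (s : R) (p : 'rV[R]_n.+1) (M : 'M[R]_(n, n.+1)) :
  M *m M^T = 1%:M -> n.+1%:R / 2 <= `|s| ->
  lebesgue_rV [set u : 'rV[R]_n | central_section n.+1 s (p + u *m M)] = 0%E.
Proof.
move=> MM hs.
suff [a ha] : exists a, central_section n.+1 s `<=` [set a].
  apply: (@lebesgue_rV_subsingleton _ _ _ ((a - p) *m M^T)) => u /= /ha /= <-.
  by rewrite addrC addKr -mulmxA MM mulmx1.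
have [s0|s0] := leP 0 s.
  exists (const_mx 2^-1) => z [z1 z2] /=.
  by apply: eq_const_half; rewrite ?z2// ger0_norm in hs *.
exists (- const_mx 2^-1) => z [z1 z2] /=.
apply/eqP; rewrite -eqr_oppLR; apply/eqP; apply: eq_const_half.
  by move=> i; rewrite mxE normrN.
by under eq_bigr do rewrite mxE; rewrite sumrN z2 -ltr0_norm.
Qed.

(** Reading the section in the basis [-e | I] eliminates the first coordinate:
    it is s minus the sum of the others, and requiring it to lie in [-1/2, 1/2]
    gives the slab. *)
Lemma chart_volume (s : R) (p : 'rV[R]_n.+1) (K : 'M[R]_n) :
  K *m (1%:M + ones *m ones^T) *m K^T = 1%:M ->
  (exists u0, const_mx (s / n.+1%:R) = p + u0 *m (K *m J)) ->
  lebesgue_rV [set u : 'rV[R]_n | central_section n.+1 s (p + u *m (K *m J))] =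
  (Num.sqrt n.+1%:R * slab_volume n s)%:E.
Proof.
move=> KK [u0 pu0]; set r := s / n.+1%:R.
have rs : r + n%:R * r = s.
  have : n.+1%:R * r = s by rewrite mulrC divfK// pnatr_eq0.
  by rewrite -natr1 mulrDl mul1r addrC.
pose B (y : 'rV[R]_n) := central_section n.+1 s (const_mx r + y *m J).
have EB y : B y <-> central_slab n s (y + const_mx r).
  have E0 : (const_mx r + y *m J : 'rV_n.+1) 0 (@lshift 1 n 0) = r - \sum_i y 0 i.
    by rewrite mxE J0 mxE.
  have ES i : (const_mx r + y *m J : 'rV_n.+1) 0 (@rshift 1 n i) = r + y 0 i.
    by rewrite mxE JS mxE.
  have EY i : (y + const_mx r) 0 i = r + y 0 i by rewrite !mxE addrC.
  have SS : \sum_(i < n) (r + y 0 i) = n%:R * r + \sum_i y 0 i.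
    by rewrite big_split /= sumr_const card_ord -(mulr_natl r).
  rewrite /B /central_section /central_slab /= sumE (eq_bigr _ (fun i _ => ES i)) E0.
  rewrite (eq_bigr (fun i => r + y 0 i) (fun i _ => EY i)) SS; split=> [[/allE [h1 h2] _]|[h1 h2]].
    split=> [i|]; first by have := h2 i; rewrite ES EY.
    by move: h1; rewrite E0 -{1}rs; congr (is_true (`|_| <= _)); ring.
  split; last by rewrite -rs; ring.
  apply/allE; split=> [|i]; last by have := h1 i; rewrite EY ES.
  by rewrite E0; move: h2; rewrite -{1}rs; congr (is_true (`|_| <= _)); ring.
have mSl := @measurable_central_slab R n s.
have ad c : measurable_rV (fun u : 'rV[R]_n => central_slab n s (u + c)).
  apply: (measurable_preim_rV (f := fun t => rv_of_tuple t + c) _ mSl) => i.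
  under eq_fun do rewrite mxE.
  by apply: measurable_funD => //; exact: measurable_coord.
have mB : measurable_rV B.
  rewrite (_ : B = (fun u : 'rV[R]_n => central_slab n s (u + const_mx r))) //.
  by apply/seteqP; split => u /EB.
transitivity (lebesgue_rV [set u | [set v | B (v *m K)] (u + (- u0))]).
  have E u : const_mx r + (u - u0) *m K *m J = p + u *m (K *m J).
    by rewrite -mulmxA mulmxBl pu0 -addrA [X in _ + X]addrC subrK.
  by congr lebesgue_rV; apply/seteqP; split => u /=; rewrite /B E.
rewrite lebesgue_rVDr; last first.
  apply: (measurable_preim_rV (f := fun t => rv_of_tuple t *m K) _ mB) => i.
  by apply: (@measurable_coord_mulmx _ _ _ n n id) => //; exact: measurable_id.
rewrite lebesgue_rV_hyperplane_chart// EFinM -slab_volumeE; congr (_ * _)%E.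
rewrite -[RHS](lebesgue_rVDr (const_mx r)) //.
by congr lebesgue_rV; apply/seteqP; split => u /EB.
Qed.

(** When the section has relative interior, it determines the direction of its
    flat: moving from the centre of the section by a small multiple e of each row of
    [-e | I] stays in the section, so these rows are combinations of those of M. *)
Lemma basis_chart (s : R) (p : 'rV[R]_n.+1) (M : 'M[R]_(n, n.+1)) :
  M *m M^T = 1%:M -> `|s| < n.+1%:R / 2 ->
  central_section n.+1 s `<=` range (fun u => p + u *m M) ->
  exists K : 'M[R]_n, [/\ M = K *m J,
    K *m (1%:M + ones *m ones^T) *m K^T = 1%:M &
    exists u0, const_mx (s / n.+1%:R) = p + u0 *m (K *m J)].
Proof.
move=> MM hs SM; set r := s / n.+1%:R.
have n0 : 0 < n.+1%:R :> R by [].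
have rh : `|r| < 2^-1.
  by rewrite normrM (ger0_norm (_ : 0 <= n.+1%:R^-1))// ltr_pdivrMr// mulrC.
(* the distance from the centre of the section to the boundary of the cube *)
pose e := 2^-1 - `|r|; have e0 : 0 < e by rewrite subr_gt0.
have secJ y : (forall i, `|(y *m J) 0 i| <= e) ->
    central_section n.+1 s (const_mx r + y *m J).
  move=> ye; split.
    move=> i; rewrite mxE mxE (le_trans (ler_normD _ _))//.
    by have := ye i; rewrite /e lerBrDl.
  under eq_bigr do rewrite mxE mxE.
  rewrite big_split /= sumr_const card_ord -(mulr_natl r) sumE J0.
  under [X in _ + (_ + X)]eq_bigr do rewrite JS.
  by rewrite addNr addr0 /r mulrC divfK// gt_eqF.
have secU y : (forall i, `|(y *m J) 0 i| <= e) ->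
    exists u, p + u *m M = const_mx r + y *m J.
  by move=> /secJ/SM[u _ pu]; exists u.
have [u0 pu0] : exists u0, p + u0 *m M = const_mx r.
  have [|u0] := secU 0; first by move=> i; rewrite mul0mx mxE normr0 ltW.
  by rewrite mul0mx addr0; exists u0.
  have HU i : exists u, p + u *m M = const_mx r + (e *: delta_mx 0 i) *m J.
    apply: secU; apply/allE; split=> [|j].
      rewrite J0; under eq_bigr do rewrite !mxE eqxx.
      rewrite (bigD1 i)//= eqxx mulr1 big1 ?addr0 ?normrN ?gtr0_norm//.
      by move=> j /negbTE ->; rewrite mulr0.
    by rewrite JS !mxE eqxx; case: eqP => _; rewrite ?mulr1 ?mulr0 ?normr0 ?gtr0_norm// ltW.
  have {HU}[U HU] := choice HU.
  pose N := \matrix_i (U i - u0).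
  have NM : N *m M = e *: J.
    apply/row_matrixP => i; rewrite row_mul rowK mulmxBl.
    apply: (addrI p); rewrite addrA HU -pu0 linearZ /= -scalemxAl -rowE.
    by rewrite addrAC addrK.
  pose K := M *m P.
  have NK : N *m K = e%:M by rewrite mulmxA NM -scalemxAl JP scalemx1.
  have KN : K *m N = e%:M.
    have : (e^-1 *: N) *m K = 1%:M.
      by rewrite -scalemxAl NK scale_scalar_mx mulVf// gt_eqF.
    move/mulmx1C; rewrite -scalemxAr => /(congr1 ( *:%R e)).
    by rewrite scalerA mulfV ?gt_eqF// scale1r scalemx1.
  have MK : M = K *m J.
    have := congr1 (mulmx K) NM; rewrite mulmxA KN mul_scalar_mx -scalemxAr.
    by move/(scalerI _); apply; rewrite gt_eqF.
  exists K; split => //; last by exists u0; rewrite -MK pu0.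
  by rewrite -JJ mulmxA -mulmxA -trmx_mul -MK.
Qed.

(** The volume of a subset of a flat is chosen among its values in all
    orthonormal coordinates; they all agree with the slab volume. If no coordinates
    exist the chosen value is 0, and this happens only when the slab is null. *)
Lemma flat_volume_central_section (s : R) :
  flat_volume n (central_section n.+1 s) = (Num.sqrt n.+1%:R * slab_volume n s)%:E.
Proof.
rewrite /flat_volume.
set VS := [set V | _].
have VE V : VS V -> V = (Num.sqrt n.+1%:R * slab_volume n s)%:E.
  move=> [p [M [MM SM ->]]]; have [hs|hs] := ltP `|s| (n.+1%:R / 2).
    have [K [-> KK hu]] := basis_chart MM hs SM.
    exact: chart_volume.
  by rewrite chart_far// slab_volume_far// mulr0.
have [VSV|VSV] := pselect (exists V, VS V); first by apply: VE; exact: xgetPex.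
rewrite xgetPN; last by move=> V' hV'; apply: VSV; exists V'.
have [hs|hs] := ltP `|s| (n.+1%:R / 2); last by rewrite slab_volume_far// mulr0.
have [K KK] := @exists_hyperplane_chart R m.
have uK : K \in unitmx.
  by move: KK; rewrite -mulmxA => /mulmx1_unit[].
exfalso; apply: VSV.
exists (lebesgue_rV [set u |
  central_section n.+1 s (const_mx (s / n.+1%:R) + u *m (K *m J))]).
exists (const_mx (s / n.+1%:R)), (K *m J); split => //.
  by rewrite trmx_mul mulmxA -(mulmxA K) JJ.
move=> z [_ zs]; pose y : 'rV[R]_n := \row_i (z 0 (@rshift 1 n i) - s / n.+1%:R).
exists (y *m invmx K) => //; rewrite mulmxA mulmxKV//.
have sr : n.+1%:R * (s / n.+1%:R) = s by rewrite mulrC divfK// pnatr_eq0.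
apply/rowP; apply/allE; split=> [|i].
  rewrite mxE J0 mxE.
  have -> : \sum_i y 0 i = \sum_i z 0 (@rshift 1 n i) - n%:R * (s / n.+1%:R).
    under eq_bigr do rewrite mxE.
    by rewrite big_split /= sumr_const card_ord -(mulr_natl (- _)) mulrN.
  move: zs sr; rewrite sumE; set a := _ / _; rewrite -natr1 mulrDl mul1r; lra.
by rewrite mxE JS !mxE addrC subrK.
Qed.
End FlatVolume.
Arguments central_section {R} d s.

Section Cube.
Context {R : realType}.

(** The flats and orthonormal coordinates of the two sets correspond to each
    other under the isometry, with the same coordinate image. *)
Lemma flat_volume_isometry k d (E : 'M[R]_d) (c : 'rV[R]_d) (S : set 'rV[R]_d) :
  E^T = E -> E *m E = 1%:M ->
  flat_volume k [set z | S (z *m E + c)] = flat_volume k S.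
Proof.
move=> ET EE; rewrite /flat_volume; congr (xget _ _).
apply/seteqP; split => V [p [M [MM SM ->]]].
  have e u : (p + u *m M) *m E + c = p *m E + c + u *m (M *m E).
    by rewrite mulmxDl -mulmxA addrAC.
  exists (p *m E + c), (M *m E); split.
  - by rewrite trmx_mul ET mulmxA -(mulmxA M) EE mulmx1.
  - move=> x Sx; have [/=|u _ pu] := SM ((x - c) *m E).
      by rewrite -mulmxA EE mulmx1 subrK.
    by exists u => //; rewrite -e pu -mulmxA EE mulmx1 subrK.
  - by congr lebesgue_rV; apply/seteqP; split => u /=; rewrite e.
have e u : (p + u *m M - c) *m E = (p - c) *m E + u *m (M *m E).
  by rewrite addrAC mulmxDl -mulmxA.
exists ((p - c) *m E), (M *m E); split.
- by rewrite trmx_mul ET mulmxA -(mulmxA M) EE mulmx1.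
- move=> z /= /SM[u _ pu]; exists u => //.
  by rewrite -e pu addrK -mulmxA EE mulmx1.
- by congr lebesgue_rV; apply/seteqP; split => u /=;
    rewrite -e -mulmxA EE mulmx1 subrK.
Qed.

(** The diagonal q - p has entries 1 and -1. Flipping the coordinates with
    entry -1 about the centre of the cube maps every diagonal to the main one. *)
Lemma flat_volume_hyperplane_cube m (p q : 'rV[R]_m.+2) (b : R) :
  opposite_vertices p q ->
  flat_volume m.+1 (hyperplane (q - p) b `&` cube m.+2) =
  (Num.sqrt m.+2%:R * slab_volume m.+1 (b - dotr (q - p) (cube_center m.+2)))%:E.
Proof.
move=> [vp vq pq]; set e := q - p.
have ee i : e 0 i * e 0 i = 1.
  rewrite !mxE; have := pq i; case: (vp i) => ->; case: (vq i) => ->; rewrite ?eqxx// => _; ring.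
pose E := diag_mx e.
have EE : E *m E = 1%:M.
  rewrite mulmx_diag -diag_const_mx; congr diag_mx; apply/rowP => i.
  by rewrite [LHS]mxE ee mxE.
rewrite -(@flat_volume_isometry _ _ E (cube_center m.+2)) ?tr_diag_mx//.
rewrite -flat_volume_central_section; congr flat_volume.
have abse i : `|e 0 i| = 1.
  by apply/eqP; rewrite -(@eqrXn2 _ 2)// ?expr1n// -normrX expr2 ee normr1.
have dE z : dotr e (z *m E + cube_center m.+2) = \sum_i z 0 i + dotr e (cube_center m.+2).
  rewrite /dotr linearD /= mulmxDr mxE; congr (_ + _).
  rewrite mxE; apply: eq_bigr => i _.
  have -> : (z *m E)^T i 0 = z 0 i * e 0 i by rewrite mxE mul_mx_diag mxE.
  by rewrite mulrCA ee mulr1.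
have xE (z : 'rV[R]_m.+2) i : (z *m E + cube_center m.+2) 0 i = z 0 i * e 0 i + 2^-1.
  by rewrite mxE mul_mx_diag mxE; congr (_ + _); rewrite mxE.
have hE (z : 'rV[R]_m.+2) i :
    (0 <= (z *m E + cube_center m.+2) 0 i <= 1) = (`|z 0 i| <= 2^-1).
  have -> : `|z 0 i| = `|z 0 i * e 0 i| by rewrite normrM abse mulr1.
  rewrite xE ler_norml.
  move: (z 0 i * e 0 i) => w; apply/idP/idP => /andP[h1 h2]; apply/andP; split; lra.
apply/seteqP; split => z; rewrite /hyperplane /central_section /cube /= dE.
  by move=> [<- zc]; split; [move=> i; rewrite -hE|rewrite addrK].
by move=> [zc zs]; split; [rewrite zs subrK|move=> i; rewrite hE].
Qed.
End Cube.

Section Distance.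
Context {R : realType}.

(** The distance is attained at the foot c + (s / d) a of the perpendicular; that
    it is a lower bound is the Cauchy-Schwarz inequality, in the form of a sum of
    squares. *)
Lemma eucl_dist_hyperplane d (a c : 'rV[R]_d) (b : R) :
  (0 < d)%N -> (forall i, a 0 i ^+ 2 = 1) ->
  eucl_dist c (hyperplane a b) = `|b - dotr a c| / Num.sqrt d%:R.
Proof.
move=> d0 a1; set s := b - dotr a c.
have dR : 0 < d%:R :> R by rewrite ltr0n.
have dotE (x y : 'rV[R]_d) : dotr x y = \sum_i x 0 i * y 0 i.
  by rewrite /dotr mxE; apply: eq_bigr => i _; rewrite mxE.
have aa : dotr a a = d%:R.
  by rewrite dotE; under eq_bigr do rewrite -expr2 a1; rewrite sumr_const card_ord.
have normE : `|s| / Num.sqrt d%:R = Num.sqrt (s ^+ 2 / d%:R).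
  by rewrite sqrtrM ?sqr_ge0// sqrtrV ?sqrtr_sqr// ltW.
rewrite normE /eucl_dist; set D := [set _ | _ in _].
have lbD : lbound D (Num.sqrt (s ^+ 2 / d%:R)).
  move=> _ [x hx <-]; apply: ler_wsqrtr.
  have ay : dotr a (x - c) = s.
    by rewrite /s -hx !dotE -sumrB; apply: eq_bigr => i _; rewrite !mxE mulrBr.
  set y := x - c in ay *.
  rewrite -subr_ge0; have -> : dotr y y - s ^+ 2 / d%:R = \sum_i (y 0 i - s / d%:R * a 0 i) ^+ 2.
    rewrite (eq_bigr (fun i => (y 0 i * y 0 i - (2 * s / d%:R) * (a 0 i * y 0 i) +
        (s / d%:R) ^+ 2))).
      rewrite !big_split /= sumr_const card_ord sumrN -mulr_sumr -!dotE ay.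
      rewrite -(mulr_natl ((s / d%:R) ^+ 2)).
      by field; rewrite gt_eqF.
    by move=> i _; rewrite sqrrB exprMn a1; ring.
  by apply: sumr_ge0 => i _; exact: sqr_ge0.
have memD : D (Num.sqrt (s ^+ 2 / d%:R)).
  exists (c + (s / d%:R) *: a); rewrite /hyperplane /=.
    rewrite /dotr linearD /= linearZ /= mulmxDr -scalemxAr !mxE.
    have := aa; rewrite /dotr mxE => ->.
    have -> : \sum_j a 0 j * c^T j 0 = dotr a c by rewrite /dotr mxE.
    by rewrite divfK ?gt_eqF// /s addrC subrK.
  rewrite addrC addKr /eucl_norm; congr Num.sqrt.
  rewrite /dotr linearZ /= -scalemxAl -scalemxAr scalerA mxE.
  by have := aa; rewrite /dotr => ->; field; rewrite gt_eqF.
apply/eqP; rewrite eq_le; apply/andP; split.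
  by apply: ge_inf => //; exists (Num.sqrt (s ^+ 2 / d%:R)).
by apply: lb_le_inf => //; exists (Num.sqrt (s ^+ 2 / d%:R)).
Qed.

(** The distance to the centre is the offset of the coordinate sum divided by
    sqrt d, and the slab volume is even in that offset. *)
Lemma flat_volume_diagonal_section m (t : R) (H : set 'rV[R]_m.+2) :
  orthogonal_to_diagonal H -> eucl_dist (cube_center m.+2) H = t ->
  flat_volume m.+1 (H `&` cube m.+2) =
  (Num.sqrt m.+2%:R * slab_volume m.+1 (Num.sqrt m.+2%:R * t))%:E.
Proof.
move=> [p [q [b [pq ->]]]]; rewrite eucl_dist_hyperplane//; last first.
  move=> i; rewrite !mxE; move: pq => [vp vq /(_ i)].
  by case: (vp i) => ->; case: (vq i) => ->; rewrite ?eqxx// => _; ring.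
move=> <-; rewrite (flat_volume_hyperplane_cube b pq).
set c := b - _; set r := Num.sqrt _.
have r0 : r != 0 by rewrite gt_eqF ?sqrtr_gt0.
have -> : r * (`|c| / r) = `|c| by rewrite mulrC divfK.
by have [_|_] := ger0P c; [|rewrite slab_volumeN].
Qed.
End Distance.

(** * Calculus on the half-line *)

Section PointwiseDerivatives.
Context {R : realType}.
Implicit Types (f g : R -> R) (x a b : R).

(** Rules of differentiation in pointwise form: they unify with explicit lambda
    expressions, and the tactic after them applies them by head symbol, leaving the
    computed derivative to be identified with the expected one. *)
Lemma is_derive_lamD f g x a b : is_derive x 1 f a -> is_derive x 1 g b ->
  is_derive x 1 (fun y => f y + g y) (a + b).
Proof. by move=> hf hg; exact: is_deriveD. Qed.

Lemma is_derive_lamB f g x a b : is_derive x 1 f a -> is_derive x 1 g b ->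
  is_derive x 1 (fun y => f y - g y) (a - b).
Proof. by move=> hf hg; exact: is_deriveB. Qed.

Lemma is_derive_lamN f x a : is_derive x 1 f a -> is_derive x 1 (fun y => - f y) (- a).
Proof. by move=> hf; exact: is_deriveN. Qed.

Lemma is_derive_lamM f g x a b : is_derive x 1 f a -> is_derive x 1 g b ->
  is_derive x 1 (fun y => f y * g y) (a * g x + f x * b).
Proof.
move=> hf hg; have h := is_deriveM hf hg.
have -> : a * g x + f x * b = f x *: b + g x *: a.
  by rewrite addrC /GRing.scale /= [a * _]mulrC.
exact: h.
Qed.

Lemma is_derive_lamX f x a n : is_derive x 1 f a ->
  is_derive x 1 (fun y => f y ^+ n) (n%:R * f x ^+ n.-1 * a).
Proof.
move=> hf; have -> : (fun y => f y ^+ n) = f ^+ n.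
  by elim: n => [|n IH]//; rewrite exprS -IH; apply/funext => y; rewrite exprS.
exact: (is_deriveX n hf).
Qed.

Lemma is_derive_lam_comp (h : R -> R) f x a b : is_derive (f x) 1 h b -> is_derive x 1 f a ->
  is_derive x 1 (fun y => h (f y)) (b * a).
Proof. by move=> hh hf; apply: (@is_derive1_comp _ h f). Qed.

Lemma is_derive_lam_cos f x a : is_derive x 1 f a ->
  is_derive x 1 (fun y => cos (f y)) (- sin (f x) * a).
Proof. by move=> hf; apply: is_derive_lam_comp. Qed.

Lemma is_derive_lam_sin f x a : is_derive x 1 f a ->
  is_derive x 1 (fun y => sin (f y)) (cos (f x) * a).
Proof. by move=> hf; apply: is_derive_lam_comp. Qed.

Lemma is_derive_lam_expR f x a : is_derive x 1 f a ->
  is_derive x 1 (fun y => expR (f y)) (expR (f x) * a).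
Proof. by move=> hf; apply: is_derive_lam_comp. Qed.

Lemma is_derive_lam_atan f x a : is_derive x 1 f a ->
  is_derive x 1 (fun y => atan (f y)) ((1 + f x ^+ 2)^-1 * a).
Proof. by move=> hf; apply: is_derive_lam_comp. Qed.
End PointwiseDerivatives.

Ltac derive_lam :=
  repeat first
    [ notypeclasses refine (is_derive_cst _ _ _)
    | notypeclasses refine (is_derive_id _ _)
    | notypeclasses refine (is_derive_lam_cos _)
    | notypeclasses refine (is_derive_lam_sin _)
    | notypeclasses refine (is_derive_lam_expR _)
    | notypeclasses refine (is_derive_lam_atan _)
    | notypeclasses refine (is_derive_lamB _ _)
    | notypeclasses refine (is_derive_lamD _ _)
    | notypeclasses refine (is_derive_lamM _ _)
    | notypeclasses refine (is_derive_lamX _ _)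
    | notypeclasses refine (is_derive_lamN _) ].
Ltac derive_to :=
  notypeclasses refine (is_derive_eq _ _); [derive_lam|rewrite /GRing.scale /=].

Section HalfLine.
Context {R : realType}.

Lemma is_derive_continuous (f f' : R -> R) :
  (forall x : R, is_derive x 1 f (f' x)) -> continuous f.
Proof.
move=> df x; apply: differentiable_continuous.
by apply/derivable1_diffP; have [] := df x.
Qed.

Notation mu := (@lebesgue_measure R).
Notation halfline := (`]0, +oo[%classic : set R).

Lemma integrable_le (A : set R) (f g : R -> R) : measurable A -> measurable_fun A f ->
  (forall x, A x -> `|f x| <= g x) -> mu.-integrable A (EFin \o g) ->
  mu.-integrable A (EFin \o f).
Proof.
move=> mA mf fg; apply: le_integrable => //; first exact/measurable_EFinP.
by move=> x Ax; rewrite /= lee_fin (le_trans (fg x Ax))// ler_norm.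
Qed.

Lemma RintegrableZl (A : set R) (k : R) (f : R -> R) : measurable A ->
  mu.-integrable A (EFin \o f) -> mu.-integrable A (EFin \o (fun x => k * f x)).
Proof.
move=> mA intf; rewrite (_ : _ \o _ = (fun x => k%:E * (EFin \o f) x)%E).
  exact: integrableZl.
by apply/funext => x; rewrite /= EFinM.
Qed.

Lemma RintegrableD (A : set R) (f g : R -> R) : measurable A ->
  mu.-integrable A (EFin \o f) -> mu.-integrable A (EFin \o g) ->
  mu.-integrable A (EFin \o (fun x => f x + g x)).
Proof.
move=> mA intf intg; rewrite (_ : _ \o _ = ((EFin \o f) \+ (EFin \o g))%E).
  exact: integrableD.
by apply/funext => x; rewrite /= EFinD.
Qed.

Lemma RintegrableB (A : set R) (f g : R -> R) : measurable A ->
  mu.-integrable A (EFin \o f) -> mu.-integrable A (EFin \o g) ->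
  mu.-integrable A (EFin \o (fun x => f x - g x)).
Proof.
move=> mA intf intg; rewrite (_ : _ \o _ = ((EFin \o f) \- (EFin \o g))%E).
  exact: integrableB.
by apply/funext => x; rewrite /= EFinB.
Qed.

Lemma Rdominated_cvg (A : set R) (f_ : nat -> R -> R) (f g : R -> R) :
  measurable A -> (forall n, measurable_fun A (f_ n)) -> measurable_fun A f ->
  {ae mu, forall x, A x -> f_ ^~ x @ \oo --> f x} ->
  mu.-integrable A (EFin \o g) -> (forall n x, A x -> `|f_ n x| <= g x) ->
  (fun n => \int[mu]_(x in A) f_ n x) @ \oo --> \int[mu]_(x in A) f x.
Proof.
move=> mA mf_ mf ff ig fg.
have m1 n : measurable_fun A (EFin \o f_ n) by exact/measurable_EFinP.
have m2 : measurable_fun A (EFin \o f) by exact/measurable_EFinP.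
have m3 : {ae mu, forall x, A x -> (EFin \o f_ n) x @[n --> \oo] --> (EFin \o f) x}.
  move: ff => [N [mN N0 subN]]; exists N; split => // x /= hx; apply: subN => /= h.
  by apply: hx => Ax; apply: cvg_EFin; [exact: nearW|exact: h].
have m4 : {ae mu, forall x n, A x -> (`|(EFin \o f_ n) x| <= (EFin \o g) x)%E}.
  by apply: aeW => x n Ax /=; rewrite lee_fin fg.
have [int_f _ h] := @dominated_convergence _ _ _ mu A mA (fun n => EFin \o f_ n)
  (EFin \o f) (EFin \o g) m1 m2 m3 ig m4.
apply: fine_cvg; rewrite fineK //.
exact: integrable_fin_num.
Qed.

(** The fundamental theorem of calculus on the half-line for integrands of any
    sign: truncate at n + 1 and use dominated convergence, the integrand itself
    being the dominating function. *)
Lemma halfline_FTC (f F : R -> R) (l : R) :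
  (forall x : R, is_derive x 1 F (f x)) -> continuous f ->
  mu.-integrable halfline (EFin \o f) -> F x @[x --> +oo] --> l ->
  \int[mu]_(x in halfline) f x = l - F 0.
Proof.
move=> dF cf intf Fl.
have mf : measurable_fun halfline f by have /measurable_int/measurable_EFinP := intf.
have step n : \int[mu]_(x in halfline) (f \_ `]0, n.+1%:R]) x = F n.+1%:R - F 0.
  rewrite -Rintegral_mkcondr (_ : _ `&` _ = `]0, n.+1%:R]%classic); last first.
    by apply/seteqP; split => x /=; rewrite !in_itv/=; [move=> []|case/andP => -> ->].
  have cw : {within `[0, n.+1%:R], continuous f}.
    by apply: continuous_subspaceT.
  have ic : mu.-integrable `[0, n.+1%:R] (EFin \o f).
    by apply: continuous_compact_integrable => //; exact: segment_compact.
  rewrite Rintegral_itv_obnd_cbnd; last by apply: integrableS ic => //; exact: subset_itv_oc_cc.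
  rewrite /Rintegral (@continuous_FTC2 _ f F)//.
    split.
    - by move=> x _; have [] := dF x.
    - by apply: cvg_at_right_filter; exact: is_derive_continuous dF _.
    - by apply: cvg_at_left_filter; exact: is_derive_continuous dF _.
  by move=> x _; rewrite derive1E; have [] := dF x.
have c1 : (fun n => \int[mu]_(x in halfline) (f \_ `]0, n.+1%:R]) x) @ \oo --> l - F 0.
  under eq_fun do rewrite step.
  apply: cvgB; last exact: cvg_cst.
  have /cvg_pinftyP/(_ (fun n => n.+1%:R)) := Fl; apply.
  rewrite (cvg_shiftS (fun n : nat => n%:R : R)).
  exact: cvgr_idn.
have c2 : (fun n => \int[mu]_(x in halfline) (f \_ `]0, n.+1%:R]) x) @ \oo -->
    \int[mu]_(x in halfline) f x.
  apply: (@Rdominated_cvg _ _ _ (fun x => `|f x|)) => //.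
  - move=> n; apply/measurable_restrict => //.
    by apply: measurable_funS mf => //; apply: subIsetl.
  - apply: aeW => x /=; rewrite in_itv/= andbT => x0.
    apply: cvg_near_cst; near=> n; rewrite patchE mem_set// /= in_itv/= x0/=.
    near: n; have [N _ hN] := nbhs_infty_gtr x.
    by exists N => // n Nn; apply/ltW/(lt_le_trans (hN n Nn)); rewrite ler_nat.
  - exact: integrable_norm.
  - by move=> n x _; rewrite patchE; case: ifP => // _; rewrite normr0 normr_ge0.
by apply: cvg_unique c2 c1; exact: norm_hausdorff.
Unshelve. all: by end_near. Qed.
End HalfLine.

(** * Powers of sin x / x *)

Section TaylorBounds.
Context {R : realType}.
Implicit Types x y : R.

Lemma ge0_of_derive (f f' : R -> R) : (forall x, is_derive x 1 f (f' x)) ->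
  0 <= f 0 -> (forall x, 0 <= x -> 0 <= f' x) -> forall x, 0 <= x -> 0 <= f x.
Proof.
move=> df f0 f'0 x x0; apply: (le_trans f0).
have cf : {within `[0, x], continuous f}.
  apply: continuous_subspaceT => y; apply: differentiable_continuous.
  by apply/derivable1_diffP; have [] := df y.
apply: (@ger0_derive1_le_cc _ f 0 x) => //.
- move=> y; rewrite in_itv /= => /andP[y0 _]; rewrite derive1E.
  by have [_ ->] := df y; exact/f'0/ltW.
- by rewrite in_itv/= lexx.
- by rewrite in_itv/= lexx andbT.
Qed.

(** Each of the following Taylor bounds is the integral of the previous one. *)
Lemma sin_le x : 0 <= x -> 0 <= x - sin x.
Proof.
have d y : is_derive y 1
    (fun x => x - sin x)
    (1 - cos y).
  by derive_to; ring.
apply: (ge0_of_derive d); first by rewrite sin0 subr0.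
by move=> y _; rewrite subr_ge0 cos_le1.
Qed.

Lemma cos_ge2 x : 0 <= x -> 0 <= cos x - 1 + x ^+ 2 / 2.
Proof.
have d y : is_derive y 1
    (fun x => cos x - 1 + x ^+ 2 / 2)
    (y - sin y).
  by derive_to; field.
apply: (ge0_of_derive d); first by rewrite cos0 expr0n /=; lra.
exact: sin_le.
Qed.

Lemma sin_ge3 x : 0 <= x -> 0 <= sin x - x + x ^+ 3 / 6.
Proof.
have d y : is_derive y 1
    (fun x => sin x - x + x ^+ 3 / 6)
    (cos y - 1 + y ^+ 2 / 2).
  by derive_to; field.
apply: (ge0_of_derive d); first by rewrite sin0 expr0n /=; lra.
exact: cos_ge2.
Qed.

Lemma cos_le4 x : 0 <= x -> 0 <= 1 - x ^+ 2 / 2 + x ^+ 4 / 24 - cos x.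
Proof.
have d y : is_derive y 1
    (fun x => 1 - x ^+ 2 / 2 + x ^+ 4 / 24 - cos x)
    (sin y - y + y ^+ 3 / 6).
  by derive_to; field.
apply: (ge0_of_derive d); first by rewrite cos0 !expr0n /=; lra.
exact: sin_ge3.
Qed.

Lemma sin_le5 x : 0 <= x -> 0 <= x - x ^+ 3 / 6 + x ^+ 5 / 120 - sin x.
Proof.
have d y : is_derive y 1
    (fun x => x - x ^+ 3 / 6 + x ^+ 5 / 120 - sin x)
    (1 - y ^+ 2 / 2 + y ^+ 4 / 24 - cos y).
  by derive_to; field.
apply: (ge0_of_derive d); first by rewrite sin0 !expr0n /=; lra.
exact: cos_le4.
Qed.

Lemma cos_ge6 x : 0 <= x -> 0 <= cos x - 1 + x ^+ 2 / 2 - x ^+ 4 / 24 + x ^+ 6 / 720.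
Proof.
have d y : is_derive y 1
    (fun x => cos x - 1 + x ^+ 2 / 2 - x ^+ 4 / 24 + x ^+ 6 / 720)
    (y - y ^+ 3 / 6 + y ^+ 5 / 120 - sin y).
  by derive_to; field.
apply: (ge0_of_derive d); first by rewrite cos0 !expr0n /=; lra.
exact: sin_le5.
Qed.

Lemma sin_ge7 x : 0 <= x ->
  0 <= sin x - x + x ^+ 3 / 6 - x ^+ 5 / 120 + x ^+ 7 / 5040.
Proof.
have d y : is_derive y 1
    (fun x => sin x - x + x ^+ 3 / 6 - x ^+ 5 / 120 + x ^+ 7 / 5040)
    (cos y - 1 + y ^+ 2 / 2 - y ^+ 4 / 24 + y ^+ 6 / 720).
  by derive_to; field.
apply: (ge0_of_derive d); first by rewrite sin0 !expr0n /=; lra.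
exact: cos_ge6.
Qed.

Lemma expRN_le2 x : 0 <= x -> 0 <= 1 - x + x ^+ 2 / 2 - expR (- x).
Proof.
have d y : is_derive y 1
    (fun x => 1 - x + x ^+ 2 / 2 - expR (- x))
    (expR (- y) - (1 - y)).
  by derive_to; field.
apply: (ge0_of_derive d); first by rewrite oppr0 expR0 !expr0n /=; lra.
by move=> y _; rewrite subr_ge0 expR_ge1Dx.
Qed.

Lemma expRN_ge3 x : 0 <= x -> 0 <= expR (- x) - 1 + x - x ^+ 2 / 2 + x ^+ 3 / 6.
Proof.
have d y : is_derive y 1
    (fun x => expR (- x) - 1 + x - x ^+ 2 / 2 + x ^+ 3 / 6)
    (1 - y + y ^+ 2 / 2 - expR (- y)).
  by derive_to; field.
apply: (ge0_of_derive d); first by rewrite oppr0 expR0 !expr0n /=; lra.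
exact: expRN_le2.
Qed.

Lemma pow_le_expR k x : 0 <= x -> 0 <= k`!%:R * expR x - x ^+ k.
Proof.
elim: k x => [|k IH].
  by move=> x x0; rewrite fact0 mul1r expr0 subr_ge0 (le_trans _ (expR_ge1Dx _))// lerDl.
have d y : is_derive y 1
    (fun x => k.+1`!%:R * expR x - x ^+ k.+1)
    (k.+1%:R * (k`!%:R * expR y - y ^+ k)).
  by rewrite factS natrM; derive_to; ring.
apply: (ge0_of_derive d); first by rewrite expR0 expr0n /= mulr1 subr0.
by move=> y y0; rewrite mulr_ge0// IH.
Qed.
End TaylorBounds.

Section SincPower.
Context {R : realType}.
Implicit Types x y : R.

(** The second-order approximation of (sin x / x)^d: the exponential of d times the
    quadratic part of log (sin x / x), which is - x^2 / 6 - x^4 / 180 + ...,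
    with the quartic part linearised. *)
Definition corrected_gauss (d : nat) x : R :=
  expR (- (d%:R * x ^+ 2 / 6)) * (1 - d%:R * x ^+ 4 / 180).

Lemma sinc_le1 x : 0 < x -> `|sin x / x| <= 1.
Proof.
move=> x0; rewrite normf_div (gtr0_norm x0) ler_pdivrMr// mul1r ler_norml.
have s1 := sin_le (ltW x0); have s3 := sin_ge3 (ltW x0).
have [x2|x2] := leP x 2; last first.
  by have := sin_geN1 x; have := sin_le1 x => *; apply/andP; split; lra.
apply/andP; split; last by lra.
have : x ^+ 3 <= 4 * x by rewrite exprSr; apply: ler_wpM2r; [exact: ltW|nra].
lra.
Qed.

Lemma norm_sinc_leV x : 0 < x -> `|sin x / x| <= x^-1.
Proof.
move=> x0; rewrite normf_div (gtr0_norm x0) ler_pdivrMr// mulVf ?gt_eqF//.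
by rewrite ler_norml sin_geN1 sin_le1.
Qed.

Lemma sinc_upper x : 0 < x -> sin x / x <= 1 - x ^+ 2 / 6 + x ^+ 4 / 120.
Proof.
move=> x0; rewrite ler_pdivrMr//; have := sin_le5 (ltW x0).
by move=> h; rewrite -subr_ge0; move: h; congr (is_true (_ <= _)); ring.
Qed.

Lemma sinc_lower x : 0 < x ->
  1 - x ^+ 2 / 6 + x ^+ 4 / 120 - x ^+ 6 / 5040 <= sin x / x.
Proof.
move=> x0; rewrite ler_pdivlMr//; have := sin_ge7 (ltW x0).
by move=> h; rewrite -subr_ge0; move: h; congr (is_true (_ <= _)); ring.
Qed.

Lemma sinc_far x : 1 <= x -> `|sin x / x| <= 17 / 20.
Proof.
move=> x1; have x0 : 0 < x by lra.
have [x2|x2] := leP x 2; last first.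
  apply: (le_trans (norm_sinc_leV x0)); rewrite -[_^-1]mul1r ler_pdivrMr//; lra.
rewrite ler_norml; apply/andP; split; last first.
  apply: (le_trans (sinc_upper x0)).
  have -> : x ^+ 4 = (x ^+ 2) * (x ^+ 2) by ring.
  have : 1 <= x ^+ 2 by nra. have : x ^+ 2 <= 4 by nra.
  move: (x ^+ 2) => y *; nra.
have := sin_ge3 (ltW x0) => h.
apply: (@le_trans _ _ 0); first by lra.
rewrite divr_ge0 ?ltW//.
have : x ^+ 3 <= 4 * x by rewrite exprSr; apply: ler_wpM2r; [exact: ltW|nra].
lra.
Qed.

Lemma norm_subX_le (a b M : R) n : 0 <= a <= M -> 0 <= b <= M ->
  `|a ^+ n.+1 - b ^+ n.+1| <= n.+1%:R * M ^+ n * `|a - b|.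
Proof.
move=> /andP[a0 aM] /andP[b0 bM]; have M0 : 0 <= M by exact: le_trans aM.
elim: n => [|n IH]; first by rewrite !expr1 expr0 !mul1r.
have -> : a ^+ n.+2 - b ^+ n.+2 = a * (a ^+ n.+1 - b ^+ n.+1) + (a - b) * b ^+ n.+1.
  by rewrite !exprS; ring.
apply: (le_trans (ler_normD _ _)); rewrite !normrM.
rewrite (_ : n.+2%:R * M ^+ n.+1 * `|a - b| =
   M * (n.+1%:R * M ^+ n * `|a - b|) + `|a - b| * M ^+ n.+1); last first.
  by rewrite -[n.+2%:R]natr1 exprS; ring.
rewrite lerD//; first by rewrite ler_pM// ger0_norm.
by rewrite ler_wpM2l// normrX ger0_norm// ler_pXn2r.
Qed.

(** Bernoulli's inequality and its second-order counterpart. *)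
Lemma pow_1B_le (z : R) n : 0 <= z <= 1 ->
  `|(1 - z) ^+ n - (1 - n%:R * z)| <= n%:R ^+ 2 * z ^+ 2.
Proof.
move=> /andP[z0 z1].
suff : 1 - n%:R * z <= (1 - z) ^+ n <= 1 - n%:R * z + n%:R ^+ 2 * z ^+ 2.
  by move=> /andP[h1 h2]; rewrite ger0_norm ?subr_ge0//; lra.
elim: n => [|n /andP[h1 h2]]; first by rewrite expr0 !mul0r subr0 expr0n /= mul0r addr0 lexx.
have n0 : 0 <= n%:R :> R by [].
rewrite exprS -natr1; apply/andP; split.
  apply: (@le_trans _ _ ((1 - z) * (1 - n%:R * z))); last first.
    by rewrite ler_wpM2l// subr_ge0.
  have : 0 <= n%:R * z ^+ 2 by rewrite mulr_ge0// sqr_ge0.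
  by lra.
apply: (le_trans (ler_wpM2l _ h2)); first by rewrite subr_ge0.
rewrite -subr_ge0 (_ : _ - _ = (n%:R + 1) * z ^+ 2 + n%:R ^+ 2 * z ^+ 3); last by ring.
by rewrite addr_ge0// mulr_ge0 ?addr_ge0// ?exprn_ge0.
Qed.

(** Both sides agree up to order x^4, as 1/72 - 1/180 = 1/120. *)
Lemma sinc_near x : 0 < x -> x <= 1 ->
  `|sin x / x - expR (- (x ^+ 2 / 6)) * (1 - x ^+ 4 / 180)| <= x ^+ 6.
Proof.
move=> x0 x1; have lo := sinc_lower x0; have up := sinc_upper x0.
have y0 : 0 <= x ^+ 2 / 6 by rewrite divr_ge0 ?sqr_ge0.
have e2 := expRN_le2 y0; have e3 := expRN_ge3 y0.
have x4E : x ^+ 4 = x ^+ 2 * x ^+ 2 by ring.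
have x6E : x ^+ 6 = x ^+ 2 * x ^+ 2 * x ^+ 2 by ring.
move: (sin x / x) (expR _) lo up e2 e3 => s e; rewrite x4E x6E.
have : x ^+ 2 <= 1 by nra.
have : 0 <= x ^+ 2 by exact: sqr_ge0.
move: (x ^+ 2) => {x0 x1 y0 x4E x6E x} y y0 y1 lo up e2 e3.
have c0 : 0 <= 1 - y * y / 180 by nra.
have hu : e * (1 - y * y / 180) <= (1 - y / 6 + (y / 6) ^+ 2 / 2) * (1 - y * y / 180).
  by rewrite ler_wpM2r//; lra.
have hl : (1 - y / 6 + (y / 6) ^+ 2 / 2 - (y / 6) ^+ 3 / 6) * (1 - y * y / 180) <=
    e * (1 - y * y / 180).
  by rewrite ler_wpM2r//; lra.
have y3 : 0 <= y * y * y by rewrite !mulr_ge0.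
have y4 : 0 <= y * y * y * y by rewrite !mulr_ge0.
have y4' : y * y * y * y <= y * y * y by rewrite ler_piMr.
have y5 : 0 <= y * y * y * y * y by rewrite !mulr_ge0.
have y5' : y * y * y * y * y <= y * y * y * y by rewrite ler_piMr.
rewrite ler_norml; apply/andP; split; lra.
Qed.

Lemma pow_mul_expRN_le k (v : R) : 0 <= v -> v ^+ k * expR (- (2 * v)) <= k`!%:R * expR (- v).
Proof.
move=> v0; have h := pow_le_expR k v0; rewrite subr_ge0 in h.
rewrite (_ : - (2 * v) = - v + - v); last by ring.
rewrite expRD mulrA ler_wpM2r ?expR_ge0// expRN ler_pdivrMr ?expR_gt0//.
Qed.

Definition near_const : R := 6 * 32 ^+ 3 + 24 * 32 ^+ 4.

(** With v = d y / 32, the two monomials are 32^3 v^3 / d^2 and 32^4 v^4 / d^2;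
    half of the exponential absorbs the powers of v. The constants are therefore
    32^k times k!. *)
Lemma poly_tail_le (d : nat) (y : R) : (0 < d)%N -> 0 <= y ->
  (d%:R * y ^+ 3 + d%:R ^+ 2 * y ^+ 4) * expR (- (d%:R * y / 16)) <=
  near_const / d%:R ^+ 2 * expR (- (d%:R * y / 32)).
Proof.
move=> d0 y0; have D0 : 0 < d%:R :> R by rewrite ltr0n.
pose v := d%:R * y / 32; have v0 : 0 <= v by rewrite !mulr_ge0// ltW.
have yE : y = 32 * v / d%:R by rewrite /v; field; rewrite gt_eqF.
have h3 := pow_mul_expRN_le 3 v0; have h4 := pow_mul_expRN_le 4 v0.
rewrite (_ : d%:R * y / 16 = 2 * v); last by rewrite /v; field.
rewrite -/v {1}yE {1}yE /near_const.
rewrite (_ : (_ + _) * _ = (32 ^+ 3 * (v ^+ 3 * expR (- (2 * v))) +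
   32 ^+ 4 * (v ^+ 4 * expR (- (2 * v)))) / d%:R ^+ 2); last by field; rewrite gt_eqF.
rewrite [leRHS]mulrAC ler_pM2r ?invr_gt0 ?exprn_gt0//.
by move: h3 h4; rewrite !factS fact0 /= => h3 h4; lra.
Qed.

(** Compare (sin x / x)^d with the d-th power of the one-factor approximation of
    sinc_near, which costs d times the sixth power of x, then linearise the
    quartic factor, which costs d^2 times the eighth power of x. The Gaussian
    factors survive because all the bases are at most exp (- x^2 / 8). *)
Lemma sinc_pow_near (d : nat) x : (1 < d)%N -> 0 < x -> x <= 1 ->
  `|(sin x / x) ^+ d - corrected_gauss d x| <=
  near_const / d%:R ^+ 2 * expR (- (d%:R * x ^+ 2 / 32)).
Proof.
move=> d1 x0 x1; apply: le_trans (poly_tail_le (ltnW d1) (sqr_ge0 x)).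
have D2 : 2 <= d%:R :> R by rewrite ler_nat.
set a := sin x / x; pose b := expR (- (x ^+ 2 / 6)) * (1 - x ^+ 4 / 180).
pose M := expR (- (x ^+ 2 / 8)).
have x2 : 0 <= x ^+ 2 <= 1 by rewrite sqr_ge0 /= expr_le1// ltW.
have x4 : 0 <= x ^+ 4 <= x ^+ 2.
  rewrite (_ : x ^+ 4 = x ^+ 2 * x ^+ 2); last by ring.
  by case/andP: x2 => *; rewrite mulr_ge0//= ler_piMr.
have x6 : 0 <= x ^+ 6 <= x ^+ 4.
  rewrite (_ : x ^+ 6 = x ^+ 4 * x ^+ 2); last by ring.
  by case/andP: x2 => *; case/andP: x4 => *; rewrite mulr_ge0//= ler_piMr.
case/andP: x2 => x20 x21; case/andP: x4 => x40 x42; case/andP: x6 => x60 x64.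
have aM : 0 <= a <= M.
  apply/andP; split; first by apply: le_trans (sinc_lower x0); lra.
  apply: (le_trans (sinc_upper x0)); apply: le_trans (expR_ge1Dx _); lra.
have bM : 0 <= b <= M.
  have e0 := expR_ge0 (- (x ^+ 2 / 6)).
  have eM : expR (- (x ^+ 2 / 6)) <= M by rewrite ler_expR; lra.
  apply/andP; split; first by rewrite mulr_ge0//; lra.
  by apply: le_trans eM; rewrite ler_piMr//; lra.
have bd : b ^+ d = expR (- (d%:R * x ^+ 2 / 6)) * (1 - x ^+ 4 / 180) ^+ d.
  by rewrite exprMn -expRM_natl; congr (expR _ * _); ring.
have -> : a ^+ d - corrected_gauss d x = (a ^+ d - b ^+ d) +
    expR (- (d%:R * x ^+ 2 / 6)) * ((1 - x ^+ 4 / 180) ^+ d - (1 - d%:R * (x ^+ 4 / 180))).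
  by rewrite bd /corrected_gauss; ring.
apply: (le_trans (ler_normD _ _)); rewrite mulrDl; apply: lerD.
  rewrite -(ltn_predK d1); set n := d.-1.
  have dE : d = n.+1 by rewrite (ltn_predK d1).
  apply: (le_trans (norm_subX_le n aM bM)).
  have -> : n.+1%:R * (x ^+ 2) ^+ 3 * expR (- (n.+1%:R * x ^+ 2 / 16)) =
     n.+1%:R * expR (- (n.+1%:R * x ^+ 2 / 16)) * x ^+ 6 by ring.
  rewrite ler_pM//; last exact: sinc_near.
    by rewrite mulr_ge0// exprn_ge0// expR_ge0.
  rewrite ler_wpM2l// /M -expRM_natl ler_expR mulrN lerN2.
  rewrite -natr1; have n1 : 1 <= n%:R :> R by rewrite ler1n -ltnS -dE.
  have : 0 <= (n%:R - 1) * x ^+ 2 by rewrite mulr_ge0// subr_ge0.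
  lra.
rewrite normrM ger0_norm ?expR_ge0// [leRHS]mulrC; apply: ler_pM => //.
- rewrite ler_expR lerN2.
  have : 0 <= d%:R * x ^+ 2 by rewrite mulr_ge0.
  lra.
- apply: (le_trans (pow_1B_le _ _)); first by apply/andP; split; lra.
  rewrite ler_wpM2l ?sqr_ge0// (_ : (x ^+ 2) ^+ 4 = (x ^+ 4) ^+ 2); last by ring.
  rewrite ler_pXn2r ?nnegrE//; lra.
Qed.

Definition far_const : R := 12 * (40 / 3) ^+ 3.

(** Away from 0, |sin x / x| is at most 17/20; all but two of the d factors are
    used to gain an exponentially small bound, hence one in d^-3, and the last two
    make it integrable. *)
Lemma sinc_pow_far (d : nat) x : (3 < d)%N -> 1 <= x ->
  `|(sin x / x) ^+ d| <= far_const / d%:R ^+ 3 * (1 + x ^+ 2)^-1.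
Proof.
move=> d3 x1; have x0 : 0 < x by lra.
have D0 : 0 < d%:R :> R by rewrite ltr0n (ltn_trans _ d3).
have dE : d = (2 + (d - 2))%N by rewrite subnKC// (ltn_trans _ d3).
set n := (d - 2)%N in dE.
have n0 : (0 < n)%N by rewrite -(ltn_add2l 2) -dE addn0 (ltn_trans _ d3).
have n2 : d%:R / 2 <= n%:R :> R.
  have : 4 <= d%:R :> R by rewrite ler_nat.
  rewrite dE natrD; lra.
rewrite normrX {1}dE exprD.
have h1 : `|sin x / x| ^+ 2 <= 2 * (1 + x ^+ 2)^-1.
  apply: (@le_trans _ _ (x^-1 ^+ 2)).
    by rewrite ler_pXn2r ?nnegrE ?invr_ge0 ?(ltW x0)//; exact: norm_sinc_leV.
  have x2 : 1 <= x ^+ 2 by rewrite exprn_ege1.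
  rewrite exprVn -[_^-1]mul1r ler_pdivrMr ?exprn_gt0// mulrAC ler_pdivlMr; lra.
have h2 : `|sin x / x| ^+ n <= far_const / 2 / d%:R ^+ 3.
  apply: (@le_trans _ _ ((17 / 20) ^+ n)).
    by rewrite ler_pXn2r ?nnegrE//; exact: sinc_far.
  apply: (@le_trans _ _ (expR (- (3 / 20)) ^+ n)).
    rewrite ler_pXn2r ?nnegrE ?expR_ge0//.
    by apply: le_trans (expR_ge1Dx _); lra.
  rewrite -expRM_natl mulrN expRN -[_^-1]mul1r ler_pdivrMr ?expR_gt0//.
  have v0 : 0 <= 3 * d%:R / 40 :> R by rewrite !mulr_ge0// ltW.
  have := pow_le_expR 3 v0; rewrite subr_ge0 (_ : 3`!%:R = 6)// => h.
  have h' : expR (3 * d%:R / 40) <= expR (n%:R * (3 / 20)) :> R.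
    by rewrite ler_expR; lra.
  rewrite /far_const.
  rewrite (_ : _ * expR _ = (6 * expR (n%:R * (3 / 20))) / (3 * d%:R / 40) ^+ 3); last first.
    by field; rewrite gt_eqF.
  rewrite ler_pdivlMr ?mul1r; last by rewrite exprn_gt0// !mulr_gt0.
  by apply: (le_trans h); lra.
rewrite (_ : far_const / _ * _ = 2 * (1 + x ^+ 2)^-1 * (far_const / 2 / d%:R ^+ 3)); last first.
  by field; rewrite gt_eqF//= gt_eqF// ltr_pwDl// sqr_ge0.
by apply: ler_pM => //; rewrite exprn_ge0.
Qed.

Lemma sinc_pow_gauss (d : nat) x : (3 < d)%N -> 0 < x ->
  `|(sin x / x) ^+ d - corrected_gauss d x| <=
  near_const / d%:R ^+ 2 * expR (- (d%:R * x ^+ 2 / 32)) +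
  far_const / d%:R ^+ 3 * (1 + x ^+ 2)^-1.
Proof.
move=> d3 x0; have D0 : 0 < d%:R :> R by rewrite ltr0n (ltn_trans _ d3).
have D1 : 1 <= d%:R :> R by rewrite ler1n (ltn_trans _ d3).
have [x1|x1] := leP x 1.
  apply: (le_trans (sinc_pow_near _ x0 x1)); first exact: ltn_trans d3.
  rewrite lerDl mulr_ge0 ?invr_ge0 ?addr_ge0 ?sqr_ge0//.
  by rewrite divr_ge0 ?exprn_ge0// /far_const mulr_ge0// exprn_ge0// divr_ge0.
apply: (le_trans (ler_normB _ _)); rewrite addrC lerD//; last exact/sinc_pow_far/ltW.
apply: le_trans (poly_tail_le (ltn_trans _ d3) (sqr_ge0 x)) => //.
have x2 : 1 <= x ^+ 2 by rewrite exprn_ege1// ltW.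
rewrite /corrected_gauss normrM ger0_norm ?expR_ge0// mulrC.
have h0 : 0 <= d%:R * x ^+ 2 by rewrite mulr_ge0// ?sqr_ge0 ?ltW.
apply: ler_pM => //; last by rewrite ler_expR; lra.
have dx : 1 <= d%:R * (x ^+ 2) ^+ 3 by rewrite -[leLHS]mulr1 ler_pM// exprn_ege1.
have dx' : d%:R * x ^+ 4 <= d%:R ^+ 2 * (x ^+ 2) ^+ 4.
  rewrite ler_pM ?exprn_ge0 ?(ltW D0) ?(ltW x0)//.
    by rewrite expr2 ler_peMl// ltW.
  by rewrite -exprM ler_weXn2l// ltW.
have q0 : 0 <= d%:R * x ^+ 4 by rewrite mulr_ge0 ?exprn_ge0 ?ltW.
rewrite ler_norml; apply/andP; split; lra.
Qed.
End SincPower.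

(** * Gaussian integrals *)

Section GaussianIntegrals.
Context {R : realType}.
Notation mu := (@lebesgue_measure R).
Notation halfline := (`]0, +oo[%classic : set R).
Implicit Types x a w : R.

Lemma oneDsqr_gt0 x : 0 < 1 + x ^+ 2.
Proof. by rewrite ltr_pwDl// sqr_ge0. Qed.

Lemma integrable_oneDsqrV : mu.-integrable halfline (fun x => ((1 + x ^+ 2)^-1)%:E).
Proof.
have mf : measurable_fun halfline (fun x : R => ((1 + x ^+ 2)^-1)%:E).
  apply/measurable_EFinP; apply: measurable_funTS; apply: continuous_measurable_fun.
  by move=> x; exact: continuous_oneDsqrV.
apply/integrableP; split => //.
under eq_integral do rewrite gee0_abs ?lee_fin ?invr_ge0 ?ltW ?oneDsqr_gt0//.
by rewrite integral_itv_obnd_cbnd// integral0y_oneDsqr ltry.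
Qed.

(** The inverse of 1 + x^2 serves as the only comparison function for
    integrability, its integral being pi / 2. *)
Lemma integrable_decay (f : R -> R) (K : R) : measurable_fun halfline f ->
  (forall x, 0 < x -> `|f x| <= K * (1 + x ^+ 2)^-1) ->
  mu.-integrable halfline (EFin \o f).
Proof.
move=> mf fK; apply: (@integrable_le _ _ _ (fun x => K * (1 + x ^+ 2)^-1)) => //.
  by move=> x /=; rewrite in_itv/= andbT => /fK.
exact: (RintegrableZl K _ integrable_oneDsqrV).
Qed.

Lemma cvg_decay (f : R -> R) (K : R) :
  (forall x, 0 < x -> `|f x| <= K * (1 + x ^+ 2)^-1) -> f x @[x --> +oo] --> 0.
Proof.
move=> fK; apply/cvgr0Pnorm_lt => e e0; near=> x.
have x1 : 1 < x by near: x; apply: nbhs_pinfty_gt; exact: num_real.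
have xK : `|K| / e < x by near: x; apply: nbhs_pinfty_gt; exact: num_real.
have x0 : 0 < x by lra.
apply: (le_lt_trans (fK x x0)); rewrite ltr_pdivrMr ?oneDsqr_gt0//.
move: xK; rewrite ltr_pdivrMr// => xK.
apply: (le_lt_trans (ler_norm K)); apply: (lt_trans xK).
rewrite mulrC ltr_pM2l// expr2.
have : x < x * x by rewrite ltr_pMr.
lra.
Unshelve. all: by end_near. Qed.

Lemma pow_gauss_decay (k : nat) a : 0 < a -> (k <= 4)%N ->
  exists K : R, forall x, 0 <= x -> x ^+ k * expR (- (a * x ^+ 2)) <= K * (1 + x ^+ 2)^-1.
Proof.
move=> a0 k4.
have B j x : (x ^+ 2) ^+ j * expR (- (a * x ^+ 2)) <= j`!%:R / a ^+ j.
  have ax0 : 0 <= a * x ^+ 2 by rewrite mulr_ge0 ?sqr_ge0 ?ltW.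
  have := pow_le_expR j ax0; rewrite subr_ge0 exprMn => h.
  by rewrite expRN ler_pdivrMr ?expR_gt0// mulrAC ler_pdivlMr ?exprn_gt0// mulrC.
exists (0`!%:R / a ^+ 0 + 1`!%:R / a ^+ 1 + 2`!%:R / a ^+ 2 + 3`!%:R / a ^+ 3) => x x0.
rewrite ler_pdivlMr ?oneDsqr_gt0//.
have E0 := expR_ge0 (- (a * x ^+ 2)).
have xk : x ^+ k <= 1 + x ^+ 4.
  have [x1|x1] := leP x 1.
    by rewrite (@le_trans _ _ 1)// ?exprn_ile1// lerDl exprn_ge0.
  by rewrite (@le_trans _ _ (x ^+ 4))// ?ler_weXn2l ?ltW// ltrDr.
apply: (@le_trans _ _ ((1 + x ^+ 4) * expR (- (a * x ^+ 2)) * (1 + x ^+ 2))).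
  by apply: ler_wpM2r; [exact/ltW/oneDsqr_gt0|exact: ler_wpM2r].
rewrite (_ : _ * _ = (x ^+ 2) ^+ 0 * expR (- (a * x ^+ 2)) + (x ^+ 2) ^+ 1 * expR (- (a * x ^+ 2)) +
   (x ^+ 2) ^+ 2 * expR (- (a * x ^+ 2)) + (x ^+ 2) ^+ 3 * expR (- (a * x ^+ 2))); last by ring.
by rewrite !lerD.
Qed.

Definition gauss_cos (k : nat) a w : R :=
  \int[mu]_(x in halfline) (x ^+ k * expR (- (a * x ^+ 2)) * cos (w * x)).
Definition gauss_sin (k : nat) a w : R :=
  \int[mu]_(x in halfline) (x ^+ k * expR (- (a * x ^+ 2)) * sin (w * x)).

Lemma continuous_gauss_cos k a w : continuous (fun x : R =>
   x ^+ k * expR (- (a * x ^+ 2)) * cos (w * x)).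
Proof. by apply: is_derive_continuous => x; derive_to; reflexivity. Qed.

Lemma continuous_gauss_sin k a w : continuous (fun x : R =>
   x ^+ k * expR (- (a * x ^+ 2)) * sin (w * x)).
Proof. by apply: is_derive_continuous => x; derive_to; reflexivity. Qed.

Let decay_trig (f : R -> R) k a : 0 < a -> (k <= 4)%N -> (forall x, `|f x| <= 1) ->
  exists K : R, forall x, 0 < x -> `|x ^+ k * expR (- (a * x ^+ 2)) * f x| <= K * (1 + x ^+ 2)^-1.
Proof.
move=> a0 k4 f1; have [K hK] := pow_gauss_decay a0 k4; exists K => x x0.
apply: le_trans (hK x (ltW x0)); rewrite normrM ger0_norm; last first.
  by rewrite mulr_ge0 ?exprn_ge0 ?expR_ge0// ltW.
by rewrite ler_piMr// mulr_ge0 ?exprn_ge0 ?expR_ge0// ltW.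
Qed.

Let cos1 w x : `|cos (w * x)| <= 1. Proof. by rewrite ler_norml cos_geN1 cos_le1. Qed.
Let sin1 w x : `|sin (w * x)| <= 1. Proof. by rewrite ler_norml sin_geN1 sin_le1. Qed.

Lemma integrable_gauss_cos k a w : 0 < a -> (k <= 4)%N ->
  mu.-integrable halfline (EFin \o (fun x => x ^+ k * expR (- (a * x ^+ 2)) * cos (w * x))).
Proof.
move=> a0 k4; have [K hK] := decay_trig a0 k4 (cos1 w).
apply: integrable_decay hK; apply: measurable_funTS.
apply: continuous_measurable_fun; exact: continuous_gauss_cos.
Qed.

Lemma integrable_gauss_sin k a w : 0 < a -> (k <= 4)%N ->
  mu.-integrable halfline (EFin \o (fun x => x ^+ k * expR (- (a * x ^+ 2)) * sin (w * x))).
Proof.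
move=> a0 k4; have [K hK] := decay_trig a0 k4 (sin1 w).
apply: integrable_decay hK; apply: measurable_funTS.
apply: continuous_measurable_fun; exact: continuous_gauss_sin.
Qed.

(** Integrate the derivative of x^k exp (- a x^2) sin (w x), which vanishes at
    both ends of the half-line. For k = 0 the first term has coefficient 0. *)
Lemma gauss_sin_rec k a w : 0 < a -> (k < 4)%N ->
  2 * a * gauss_sin k.+1 a w = k%:R * gauss_sin k.-1 a w + w * gauss_cos k a w.
Proof.
move=> a0 k4.
pose F x := x ^+ k * expR (- (a * x ^+ 2)) * sin (w * x).
pose f x := k%:R * (x ^+ k.-1 * expR (- (a * x ^+ 2)) * sin (w * x))
   + w * (x ^+ k * expR (- (a * x ^+ 2)) * cos (w * x))
   - 2 * a * (x ^+ k.+1 * expR (- (a * x ^+ 2)) * sin (w * x)).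
have dF x : is_derive x 1 F (f x).
  by rewrite /F /f; derive_to; rewrite (exprS x k); ring.
have cf : continuous f.
  by apply: is_derive_continuous => x; rewrite /f; derive_to; reflexivity.
have k3 : (k.-1 <= 4)%N by rewrite (leq_trans (leq_pred _))// ltnW.
have i1 := integrable_gauss_sin w a0 k3.
have i2 := integrable_gauss_cos w a0 (ltnW k4).
have i3 := integrable_gauss_sin w a0 k4.
have mH : measurable halfline by [].
have j1 := RintegrableZl k%:R mH i1.
have j2 := RintegrableZl w mH i2.
have j3 := RintegrableZl (2 * a) mH i3.
have j12 := RintegrableD mH j1 j2.
have j := RintegrableB mH j12 j3.
have F0 : F x @[x --> +oo] --> 0.
  by have [K hK] := decay_trig a0 (ltnW k4) (sin1 w); exact: cvg_decay hK.
have := halfline_FTC dF cf j F0.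
rewrite {1}/f RintegralB// RintegralD// !RintegralZl//.
rewrite /F mulr0 sin0 mulr0 subr0 => /eqP; rewrite subr_eq0 => /eqP <-; done.
Qed.

Lemma gauss_cos_rec k a w : 0 < a -> (0 < k < 4)%N ->
  2 * a * gauss_cos k.+1 a w = k%:R * gauss_cos k.-1 a w - w * gauss_sin k a w.
Proof.
move=> a0 /andP[k0 k4].
pose F x := x ^+ k * expR (- (a * x ^+ 2)) * cos (w * x).
pose f x := k%:R * (x ^+ k.-1 * expR (- (a * x ^+ 2)) * cos (w * x))
   - w * (x ^+ k * expR (- (a * x ^+ 2)) * sin (w * x))
   - 2 * a * (x ^+ k.+1 * expR (- (a * x ^+ 2)) * cos (w * x)).
have dF x : is_derive x 1 F (f x).
  by rewrite /F /f; derive_to; rewrite (exprS x k); ring.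
have cf : continuous f.
  by apply: is_derive_continuous => x; rewrite /f; derive_to; reflexivity.
have k3 : (k.-1 <= 4)%N by rewrite (leq_trans (leq_pred _))// ltnW.
have i1 := integrable_gauss_cos w a0 k3.
have i2 := integrable_gauss_sin w a0 (ltnW k4).
have i3 := integrable_gauss_cos w a0 k4.
have mH : measurable halfline by [].
have j1 := RintegrableZl k%:R mH i1.
have j2 := RintegrableZl w mH i2.
have j3 := RintegrableZl (2 * a) mH i3.
have j12 := RintegrableB mH j1 j2.
have j := RintegrableB mH j12 j3.
have F0 : F x @[x --> +oo] --> 0.
  by have [K hK] := decay_trig a0 (ltnW k4) (cos1 w); exact: cvg_decay hK.
have := halfline_FTC dF cf j F0.
rewrite {1}/f RintegralB// RintegralB// !RintegralZl//.
rewrite /F expr0n gtn_eqF// !mul0r subr0 => /eqP; rewrite subr_eq0 => /eqP <-; done.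
Qed.

(** The substitution y = sqrt a x in the Gauss integral. *)
Lemma gauss_cos00 a : 0 < a -> gauss_cos 0 a 0 = Num.sqrt (pi / a) / 2.
Proof.
move=> a0; have s0 : 0 < Num.sqrt a by rewrite sqrtr_gt0.
have mH : measurable halfline by [].
have i0 := @integrable_gauss_cos 0 a 0 a0 isT.
pose F (x : R) : R := Num.sqrt a * x.
have dF x : is_derive x 1 F (Num.sqrt a) by rewrite /F; derive_to; ring.
have F'E : derive1 F = cst (Num.sqrt a).
  by apply/funext => x; rewrite derive1E; have [] := dF x.
have F0 : F 0 = 0 by rewrite /F mulr0.
have cF : continuous F by exact: is_derive_continuous dF.
have := @increasing_ge0_integration_by_substitutiony R F gauss_fun 0.
rewrite F0 integral0y_gauss F'E.
move=> /(_ _ _ _ _ _ _ _ _)/wrap[].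
- by move=> x y _ _ xy; rewrite /F ltr_pM2l.
- by move=> x _; exact: cvg_cst.
- by apply/cvg_ex; exists (Num.sqrt a); exact: cvg_cst.
- by apply/cvg_ex; exists (Num.sqrt a); exact: cvg_cst.
- split; first by move=> x _; have [] := dF x.
  by apply: cvg_at_right_filter; exact: cF.
- by apply: gt0_cvgMry s0 _; exact: cvg_id.
- by apply: continuous_subspaceT; exact: continuous_gauss_fun.
- by move=> x _; exact: gauss_fun_ge0.
move=> E.
have : Num.sqrt pi / 2 = Num.sqrt a * gauss_cos 0 a 0.
  rewrite /gauss_cos -RintegralZl//.
  transitivity (fine (\int[mu]_(x in `[0%R, +oo[) (((gauss_fun \o F) * cst (Num.sqrt a)) x)%:E)%E).
    by rewrite -E.
  rewrite /Rintegral; congr fine.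
  rewrite -integral_itv_obnd_cbnd; last first.
    apply/measurable_EFinP; apply: measurable_funTS; apply: measurable_funM => //.
    apply: measurableT_comp; first exact: measurable_gauss_fun.
    exact: continuous_measurable_fun.
  apply: eq_integral => x _; congr EFin.
  rewrite /gauss_fun /F mul0r cos0 /= mulr1 expr0 mul1r.
  rewrite [LHS]mulrC; congr (_ * expR _).
  by rewrite exprMn sqr_sqrtr// ltW.
move/(congr1 (fun z => z / Num.sqrt a)); rewrite [RHS]mulrAC mulfV ?gt_eqF// mul1r => <-.
by rewrite sqrtrM ?pi_ge0// sqrtrV ?ltW//; ring.
Qed.

(** Differentiation under the integral sign; the derivative of the integrand is
    dominated by |x| exp (- a x^2). *)
Lemma is_derive_gauss_cos0 a w : 0 < a ->
  is_derive w 1 (gauss_cos 0 a) (- gauss_sin 1 a w).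
Proof.
move=> a0.
pose f w x := x ^+ 0 * expR (- (a * x ^+ 2)) * cos (w * x).
pose G x := `|x| * expR (- (a * x ^+ 2)).
have mH : measurable halfline by [].
have df (v x : R) : is_derive v 1 (f ^~ x) (- (x ^+ 1 * expR (- (a * x ^+ 2)) * sin (v * x))).
  by rewrite /f; derive_to; ring.
have iG : mu.-integrable halfline (EFin \o G).
  have [K hK] := @pow_gauss_decay 1 a a0 isT.
  apply: (@integrable_decay _ K).
    apply: measurable_funTS; apply: measurable_funM.
      by apply: continuous_measurable_fun; exact: norm_continuous.
    by apply: continuous_measurable_fun; apply: is_derive_continuous => x; derive_to; reflexivity.
  move=> x x0; apply: le_trans (hK x (ltW x0)).
  rewrite /G (gtr0_norm x0) expr1 ger0_norm//.
  by rewrite mulr_ge0 ?expR_ge0 ?(ltW x0).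
have p1 v x : partial1of2 f v x = - (x ^+ 1 * expR (- (a * x ^+ 2)) * sin (v * x)).
  by rewrite /partial1of2 derive1E; have [] := df v x.
have hI : (`]w - 1, w + 1[%classic : set R) w.
  by rewrite /= in_itv/=; apply/andP; split; lra.
have h1 v : (`]w - 1, w + 1[%classic : set R) v -> mu.-integrable halfline (EFin \o f v).
  by move=> _; exact: integrable_gauss_cos.
have h2 v x : (`]w - 1, w + 1[%classic : set R) v -> halfline x -> derivable (f ^~ x) v 1.
  by move=> _ _; have [] := df v x.
have h3 x : 0 <= G x by rewrite mulr_ge0 ?expR_ge0.
have h4 v x : (`]w - 1, w + 1[%classic : set R) v -> halfline x -> `|partial1of2 f v x| <= G x.
  move=> _ _; rewrite p1 normrN normrM expr1 normrM (ger0_norm (expR_ge0 _)).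
  by rewrite ler_piMr ?sin1// mulr_ge0 ?expR_ge0.
have -> : gauss_cos 0 a = (fun v => \int[mu]_(x in halfline) f v x) by [].
apply: DeriveDef.
  exact: (@derivable_under_integral R _ _ mu f halfline mH w (w - 1) (w + 1)
    hI h1 h2 G h3 iG h4).
rewrite -derive1E.
rewrite (@differentiation_under_integral R _ _ mu f halfline mH w (w - 1) (w + 1)
  hI h1 h2 G h3 iG h4).
transitivity (\int[mu]_(x in halfline)
    (-1 * (x ^+ 1 * expR (- (a * x ^+ 2)) * sin (w * x)))).
  by apply: eq_Rintegral => x _; rewrite p1 mulN1r.
by rewrite RintegralZl ?mulN1r//; exact: integrable_gauss_sin.
Qed.

(** As a function of w, the integral solves y' = - w y / (2 a), by
    gauss_sin_rec with k = 0; dividing by the Gaussian gives a constant. *)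
Lemma gauss_cos0 a w : 0 < a ->
  gauss_cos 0 a w = Num.sqrt (pi / a) / 2 * expR (- (w ^+ 2 / (4 * a))).
Proof.
move=> a0; pose psi v := gauss_cos 0 a v * expR (v ^+ 2 / (4 * a)).
have dpsi (v : R) : is_derive v 1 psi 0.
  have dc := is_derive_gauss_cos0 v a0.
  have de : is_derive v 1 (fun y => expR (y ^+ 2 / (4 * a)))
      (expR (v ^+ 2 / (4 * a)) * (v / (2 * a))).
    by derive_to; field; rewrite gt_eqF.
  apply: (is_derive_eq (is_derive_lamM dc de)).
  have := @gauss_sin_rec 0 a v a0 isT; rewrite mul0r add0r => h.
  have -> : gauss_sin 1 a v = v * gauss_cos 0 a v / (2 * a).
    by rewrite -h mulrC mulKf// mulf_neq0// gt_eqF.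
  by field; rewrite gt_eqF.
have : psi w = psi 0 by exact: is_derive_0_is_cst.
rewrite /psi expr0n /= mul0r expR0 mulr1 gauss_cos00// => <-.
by rewrite -mulrA -expRD subrr expR0 mulr1.
Qed.

(** Four steps of the recursions; the bracket is, up to scaling, a Hermite
    polynomial. *)
Lemma gauss_cos4 a w : 0 < a ->
  gauss_cos 4 a w = gauss_cos 0 a w *
    (3 / (4 * a ^+ 2) - 3 * w ^+ 2 / (4 * a ^+ 3) + w ^+ 4 / (16 * a ^+ 4)).
Proof.
move=> a0; have a2 : 2 * a != 0 by rewrite mulf_neq0// gt_eqF.
have D X Y : 2 * a * X = Y -> X = Y / (2 * a).
  by move=> <-; rewrite mulrC mulKf.
have e1 := D _ _ (@gauss_sin_rec 0 a w a0 isT).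
have e2 := D _ _ (@gauss_cos_rec 1 a w a0 isT).
have e3 := D _ _ (@gauss_sin_rec 2 a w a0 isT).
have e4 := D _ _ (@gauss_cos_rec 3 a w a0 isT).
rewrite e4 /= e3 /= e2 /= e1 /=.
by field; rewrite gt_eqF.
Qed.
End GaussianIntegrals.

(** * Cosine transforms and Fourier inversion *)

Section CosineIntegrals.
Context {R : realType}.
Notation mu := (@lebesgue_measure R).
Notation halfline := (`]0, +oo[%classic : set R).
Notation window := (`[- 2^-1, 2^-1]%classic : set R).
Implicit Types (h : R -> R) (x s : R).

(** The cosine transform in the variable 2 s, which is what makes the unit window
    correspond to the factor sin x / x. *)
Definition cosint h s : R := \int[mu]_(x in halfline) (h x * cos (2 * x * s)).

Lemma integrable_mul_bounded (A : set R) h (g : R -> R) : measurable A ->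
  mu.-integrable A (EFin \o h) -> measurable_fun A g -> (forall x, A x -> `|g x| <= 1) ->
  mu.-integrable A (EFin \o (fun x => h x * g x)).
Proof.
move=> mA ih mg g1; have /measurable_int/measurable_EFinP mh := ih.
apply: (@integrable_le _ _ _ (fun x => `|h x|)) => //.
- exact: measurable_funM.
- by move=> x Ax; rewrite normrM ler_piMr// g1.
- exact: integrable_norm.
Qed.

Let cos1 (y : R) : `|cos y| <= 1. Proof. by rewrite ler_norml cos_geN1 cos_le1. Qed.

Lemma measurable_cos_lin (A : set R) s : measurable_fun A (fun x => cos (2 * x * s)).
Proof.
apply: measurable_funTS; apply: continuous_measurable_fun.
by apply: is_derive_continuous => x; derive_to; reflexivity.
Qed.

Lemma integrable_cosint h s : mu.-integrable halfline (EFin \o h) ->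
  mu.-integrable halfline (EFin \o (fun x => h x * cos (2 * x * s))).
Proof.
by move=> ih; apply: integrable_mul_bounded => //; exact: measurable_cos_lin.
Qed.

Lemma sinc_average x s : 0 < x ->
  \int[mu]_(z in window) cos (2 * x * (s - z)) = sin x / x * cos (2 * x * s).
Proof.
move=> x0; pose F z := - (sin (2 * x * (s - z)) / (2 * x)).
have dF (z : R) : is_derive z 1 F (cos (2 * x * (s - z))).
  by rewrite /F; derive_to; field; rewrite gt_eqF.
have cf : continuous (fun z => cos (2 * x * (s - z))).
  by apply: is_derive_continuous => z; derive_to; reflexivity.
have cF := is_derive_continuous dF.
rewrite /Rintegral (@continuous_FTC2 _ _ F).
- rewrite -EFinB /= /F.
  rewrite (_ : 2 * x * (s - 2^-1) = 2 * x * s - x); last by field.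
  rewrite (_ : 2 * x * (s - - 2^-1) = 2 * x * s + x); last by field.
  by rewrite sinB sinD; field; rewrite gt_eqF.
- lra.
- exact: continuous_subspaceT.
- split.
  + by move=> z _; have [] := dF z.
  + by apply: cvg_at_right_filter; exact: cF.
  + by apply: cvg_at_left_filter; exact: cF.
- by move=> z _; rewrite derive1E; have [] := dF z.
Qed.

(** Averaging over the unit window multiplies the transform by sin x / x, by
    Fubini's theorem. *)
Lemma cosint_average h s : mu.-integrable halfline (EFin \o h) ->
  \int[mu]_(z in window) cosint h (s - z) = cosint (fun x => h x * (sin x / x)) s.
Proof.
move=> ih; have mH : measurable halfline by []. have mW : measurable window by [].
(* extension by 0, since Fubini's theorem is applied on the whole plane *)
pose hD := h \_ halfline.
have ihD : mu.-integrable setT (EFin \o hD).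
  by have := (@integrable_mkcond _ _ _ mu halfline (EFin \o h) mH).1 ih; rewrite restrict_EFin.
have mhD : measurable_fun setT hD by have /measurable_int/measurable_EFinP := ihD.
pose f (p : measurableTypeR R * measurableTypeR R) :=
  (\1_window p.1 * (hD p.2 * cos (2 * p.2 * (s - p.1))))%:E.
have mf : measurable_fun setT f.
  apply/measurable_EFinP; apply: measurable_funM.
    by apply: (measurableT_comp (measurable_indic mW)); exact: measurable_fst.
  apply: measurable_funM.
    by apply: (measurableT_comp mhD); exact: measurable_snd.
  apply: (@measurableT_comp _ _ _ _ _ _ (@cos R)).
    by apply: continuous_measurable_fun; exact: continuous_cos.
  apply: measurable_funM.
    by apply: measurable_funM => //; exact: measurable_snd.
  by apply: measurable_funB => //; exact: measurable_fst.
have C0 : (\int[mu]_x `|(hD x)%:E| < +oo)%E by have /integrableP[] := ihD.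
have mabs : measurable_fun setT (fun x : measurableTypeR R => `|(hD x)%:E|%E).
  have /measurable_int m := ihD; exact: (measurableT_comp (@abse_measurable R setT) m).
have muW : (mu window < +oo)%E.
  by rewrite lebesgue_measure_itv /= lte_fin; case: ifP => _; rewrite ?ltry// -EFinB ltry.
have imf : (mu \x mu)%E.-integrable setT f.
  apply/integrable12ltyP => //.
  apply: (@le_lt_trans _ _ (\int[mu]_z ((\1_window z)%:E * \int[mu]_x `|(hD x)%:E|))%E).
    apply: ge0_le_integral => //.
    - by move=> z _; exact: integral_ge0.
    - apply: (@measurable_fun_fubini_tonelli_F _ _ _ _ _ mu (abse \o f)).
        exact: measurableT_comp.
      by move=> z; exact: abse_ge0.
    - by apply: emeasurable_funM => //; apply/measurable_EFinP/measurable_indic.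
    - move=> z _; rewrite -ge0_integralZl//.
      apply: ge0_le_integral => //.
      + apply: measurableT_comp => //.
        exact: (measurableT_comp mf (pair1_measurable z)).
      + exact: emeasurable_funM.
      + move=> x _; rewrite /f abse_EFin /= lee_fin !normrM ger0_norm//.
        by rewrite ler_wpM2l// ler_piMr.
  rewrite ge0_integralZr//; last 2 first.
  - by apply/measurable_EFinP/measurable_indic.
  - exact: integral_ge0.
  rewrite integral_indic// setIT; apply: lte_mul_pinfty => //.
  by rewrite ge0_fin_numE.
have L : (\int[mu]_z \int[mu]_x f (z, x) = \int[mu]_(z in window) (cosint h (s - z))%:E)%E.
  rewrite [RHS]integral_mkcond; apply: eq_integral => z _; rewrite patchE /f /=.
  case: ifPn => zW; last first.
    by apply: integral0_eq => x _; rewrite indicE (negbTE zW) mul0r.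
  rewrite /cosint /Rintegral fineK; last first.
    by apply: integrable_fin_num => //; exact: (integrable_cosint (s - z) ih).
  rewrite [RHS]integral_mkcond; apply: eq_integral => x _.
  by rewrite indicE zW mul1r /hD !patchE; case: ifP => // _; rewrite mul0r.
have Rr : (\int[mu]_x \int[mu]_z f (z, x) =
    \int[mu]_(x in halfline) (h x * (sin x / x) * cos (2 * x * s))%:E)%E.
  rewrite [RHS]integral_mkcond; apply: eq_integral => x _; rewrite patchE /f /= /hD patchE.
  case: ifPn => xH; last first.
    by apply: integral0_eq => z _; rewrite mul0r mulr0.
  have x0 : 0 < x by move: xH; rewrite inE /= in_itv/= andbT.
  have cc : mu.-integrable window (EFin \o (fun z => cos (2 * x * (s - z)))).
    apply: continuous_compact_integrable; first exact: segment_compact.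
    apply: continuous_subspaceT.
    by apply: is_derive_continuous => z; derive_to; reflexivity.
  rewrite -mulrA -(sinc_average s x0) -RintegralZl// /Rintegral fineK; last first.
    by apply: integrable_fin_num => //; exact: (RintegrableZl (h x) mW cc).
  rewrite [RHS]integral_mkcond; apply: eq_integral => z _.
  by rewrite indicE patchE; case: ifP => _; rewrite ?mul1r ?mul0r.
by rewrite {1}/Rintegral -L (Fubini imf) Rr.
Qed.

Lemma continuous_cosint h : mu.-integrable halfline (EFin \o h) -> continuous (cosint h).
Proof.
move=> ih s; have mH : measurable halfline by [].
have /measurable_int/measurable_EFinP mh := ih.
apply: (@continuity_under_integral R _ _ mu (fun s x => h x * cos (2 * x * s))
  halfline mH (s - 1) (s + 1) _ _ (fun x => `|h x|)).
- by move=> t _; exact: integrable_cosint.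
- apply: aeW => x _ t _; apply: cvgMr.
  apply: (@is_derive_continuous _ (fun t => cos (2 * x * t))
    (fun t => - sin (2 * x * t) * (2 * x))) => u.
  by derive_to; ring.
- exact: integrable_norm.
- by move=> t _; apply: aeW => x _; rewrite normrM ler_piMr.
- by rewrite inE /= in_itv/=; apply/andP; split; lra.
Qed.
End CosineIntegrals.

Section Inversion.
Context {R : realType}.
Notation mu := (@lebesgue_measure R).
Notation halfline := (`]0, +oo[%classic : set R).
Notation window := (`[- 2^-1, 2^-1]%classic : set R).
Implicit Types (x s : R) (n : nat).

Let mH : measurable halfline. Proof. by []. Qed.
Let mW : measurable window. Proof. by []. Qed.

Lemma measurable_sinc : measurable_fun halfline (fun x => sin x / x).
Proof.
apply: open_continuous_measurable_fun; first exact: interval_open.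
move=> x; rewrite inE /= in_itv/= andbT => x0.
apply: cvgM; first exact: continuous_sin.
by apply: cvgV => //; rewrite gt_eqF.
Qed.

Lemma sincX_le1 n x : 0 < x -> `|(sin x / x) ^+ n| <= 1.
Proof. by move=> x0; rewrite normrX exprn_ile1// sinc_le1. Qed.

Lemma sincX_decay n x : (1 < n)%N -> 0 < x -> `|(sin x / x) ^+ n| <= 2 * (1 + x ^+ 2)^-1.
Proof.
move=> n1 x0; rewrite -(subnKC n1) exprD normrM.
apply: (@le_trans _ _ (`|(sin x / x) ^+ 2|)).
  by rewrite ler_piMr// sincX_le1.
rewrite ler_pdivlMr ?oneDsqr_gt0// mulrDr mulr1.
have h1 := sincX_le1 2 x0.
suff : `|(sin x / x) ^+ 2| * x ^+ 2 <= 1 by lra.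
have := norm_sinc_leV x0; rewrite -[x^-1]mul1r ler_pdivlMr// => h.
by rewrite normrX -exprMn exprn_ile1// mulr_ge0// ltW.
Qed.

(** A summability factor: its cosine transform is the Poisson kernel, which has an
    elementary primitive, so that the limit e -> 0 can be taken explicitly. *)
Definition poisson_weight (e : R) x : R := expR (- (e * x)).

Lemma measurable_poisson_weight e : measurable_fun halfline (poisson_weight e).
Proof.
apply: measurable_funTS; apply: continuous_measurable_fun.
by apply: is_derive_continuous => x; rewrite /poisson_weight; derive_to; reflexivity.
Qed.

Lemma integrable_poisson_weight e : 0 < e ->
  mu.-integrable halfline (EFin \o poisson_weight e).
Proof.
move=> e0; apply: (@integrable_decay _ _ (1 + 2 / e ^+ 2)); first exact: measurable_poisson_weight.
move=> x x0; rewrite ger0_norm ?expR_ge0// ler_pdivlMr ?oneDsqr_gt0//.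
have ex0 : 0 <= e * x by rewrite mulr_ge0// ltW.
have := pow_le_expR 2 ex0; rewrite subr_ge0 (_ : 2`!%:R = 2)// => h.
rewrite /poisson_weight mulrDr mulr1 lerD//.
  by rewrite -expR0 ler_expR oppr_le0.
rewrite expRN mulrC ler_pdivrMr ?expR_gt0// mulrAC ler_pdivlMr ?exprn_gt0//.
by rewrite -exprMn mulrC.
Qed.

Lemma cosint_poisson e s : 0 < e ->
  cosint (poisson_weight e) s = e / (e ^+ 2 + 4 * s ^+ 2).
Proof.
move=> e0; have D0 : 0 < e ^+ 2 + 4 * s ^+ 2.
  by rewrite ltr_pwDl ?exprn_gt0// mulr_ge0// sqr_ge0.
pose F x := expR (- (e * x)) *
  ((2 * s * sin (2 * x * s) - e * cos (2 * x * s)) / (e ^+ 2 + 4 * s ^+ 2)).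
have dF (x : R) : is_derive x 1 F (poisson_weight e x * cos (2 * x * s)).
  by rewrite /F /poisson_weight; derive_to; field; rewrite gt_eqF.
rewrite /cosint (@halfline_FTC _ _ F 0)//.
- rewrite /F !mulr0 mul0r oppr0 expR0 sin0 cos0; field; by rewrite gt_eqF.
- by apply: is_derive_continuous => x; rewrite /poisson_weight; derive_to; reflexivity.
- exact/integrable_cosint/integrable_poisson_weight.
pose C := (2 * `|s| + e) / (e ^+ 2 + 4 * s ^+ 2).
have C0 : 0 <= C by rewrite divr_ge0 ?(ltW D0)// addr_ge0 ?(ltW e0)// mulr_ge0.
apply: (@cvg_decay _ _ ((1 + 2 / e ^+ 2) * C)) => x x0.
rewrite /F normrM ger0_norm ?expR_ge0// [leRHS]mulrAC.
have ex0 : 0 <= e * x by rewrite mulr_ge0// ltW.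
apply: ler_pM; rewrite ?expR_ge0//.
  have := pow_le_expR 2 ex0; rewrite subr_ge0 (_ : 2`!%:R = 2)// => h.
  rewrite ler_pdivlMr ?oneDsqr_gt0// mulrDr mulr1 lerD//.
    by rewrite -expR0 ler_expR oppr_le0.
  rewrite expRN mulrC ler_pdivrMr ?expR_gt0// mulrAC ler_pdivlMr ?exprn_gt0//.
  by rewrite -exprMn mulrC.
rewrite normf_div (gtr0_norm D0) ler_pM2r ?invr_gt0//.
apply: (le_trans (ler_normB _ _)); rewrite lerD//.
  by rewrite !normrM ger0_norm// ler_piMr ?mulr_ge0// ler_norml sin_geN1 sin_le1.
by rewrite normrM gtr0_norm// ler_piMr ?(ltW e0)// ler_norml cos_geN1 cos_le1.
Qed.

(** The density of a sum of n + 1 uniform variables and an independent Cauchy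
    variable of scale e / 2. *)
Definition poisson_slab e n s : R :=
  2 / pi * cosint (fun x => poisson_weight e x * (sin x / x) ^+ n.+1) s.

Lemma integrable_poisson_sinc e n : 0 < e ->
  mu.-integrable halfline (EFin \o (fun x => poisson_weight e x * (sin x / x) ^+ n)).
Proof.
move=> e0; apply: integrable_mul_bounded => //.
- exact: integrable_poisson_weight.
- by apply: measurable_funX; exact: measurable_sinc.
- by move=> x /=; rewrite in_itv/= andbT => /(sincX_le1 n).
Qed.

Lemma poisson_slabS e n s : 0 < e ->
  poisson_slab e n.+1 s = \int[mu]_(z in window) poisson_slab e n (s - z).
Proof.
move=> e0; have ih := integrable_poisson_sinc n.+1 e0.
rewrite /poisson_slab RintegralZl//; last first.
  apply: continuous_compact_integrable; first exact: segment_compact.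
  apply: continuous_subspaceT => z.
  apply: (@continuous_comp _ _ _ (fun z => s - z)); last exact: continuous_cosint.
  by apply: cvgB; [exact: cvg_cst|exact: cvg_id].
rewrite cosint_average//; congr (_ * _); apply: eq_Rintegral => x _.
by rewrite [in LHS]exprSr mulrA.
Qed.

(** The Poisson kernel is the derivative of an arctangent. *)
Lemma poisson_slab0 e s : 0 < e ->
  poisson_slab e 0 s = (atan ((2 * s + 1) / e) - atan ((2 * s - 1) / e)) / pi.
Proof.
move=> e0; have ih := integrable_poisson_weight e0.
rewrite /poisson_slab -(cosint_average s ih).
have -> : \int[mu]_(z in window) cosint (poisson_weight e) (s - z) =
    \int[mu]_(z in window) (e / (e ^+ 2 + 4 * (s - z) ^+ 2)).
  by apply: eq_Rintegral => z _; rewrite cosint_poisson.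
have D0 z : 0 < e ^+ 2 + 4 * (s - z) ^+ 2.
  by rewrite ltr_pwDl ?exprn_gt0// mulr_ge0// sqr_ge0.
pose F z := - (atan (2 * (s - z) / e) / 2).
have dF (z : R) : is_derive z 1 F (e / (e ^+ 2 + 4 * (s - z) ^+ 2)).
  by rewrite /F; derive_to; field; rewrite !gt_eqF.
have cF := is_derive_continuous dF.
rewrite /Rintegral (@continuous_FTC2 _ _ F).
- rewrite -EFinB /= /F.
  rewrite (_ : 2 * (s - 2^-1) = 2 * s - 1); last by field.
  rewrite (_ : 2 * (s - - 2^-1) = 2 * s + 1); last by field.
  by have := pi_gt0 R; move: pi => p p0; field; rewrite !gt_eqF.
- lra.
- apply: continuous_subspaceT => z; apply: cvgM; first exact: cvg_cst.
  apply: cvgV; first by rewrite gt_eqF.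
  apply: (@is_derive_continuous _ (fun z => e ^+ 2 + 4 * (s - z) ^+ 2)
    (fun z => - 8 * (s - z))) => y.
  by derive_to; ring.
- split.
  + by move=> z _; have [] := dF z.
  + by apply: cvg_at_right_filter; exact: cF.
  + by apply: cvg_at_left_filter; exact: cF.
- by move=> z _; rewrite derive1E; have [] := dF z.
Qed.
End Inversion.

Section InversionLimit.
Context {R : realType}.
Notation mu := (@lebesgue_measure R).
Notation halfline := (`]0, +oo[%classic : set R).
Notation window := (`[- 2^-1, 2^-1]%classic : set R).
Implicit Types (x s : R) (n : nat).

Let mH : measurable halfline. Proof. by []. Qed.
Let mW : measurable window. Proof. by []. Qed.
Let muW : mu window = 1%:E.
Proof.
rewrite lebesgue_measure_itv /= lte_fin ifT; last by lra.
by rewrite -EFinB; congr EFin; field.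
Qed.

Let integrable1 : mu.-integrable window (EFin \o cst 1).
Proof.
apply: continuous_compact_integrable; first exact: segment_compact.
by apply: continuous_subspaceT => z; exact: cvg_cst.
Qed.

Lemma continuous_poisson_slab e n : 0 < e -> continuous (poisson_slab e n : R -> R).
Proof.
move=> e0 s; apply: cvgM; first exact: cvg_cst.
exact: (continuous_cosint (integrable_poisson_sinc n.+1 e0)).
Qed.

Lemma measurable_poisson_slabB e n s : 0 < e ->
  measurable_fun window (fun z => poisson_slab e n (s - z)).
Proof.
move=> e0; apply: measurable_funTS; apply: continuous_measurable_fun => z.
apply: (@continuous_comp _ _ _ (fun z => s - z)); last exact: continuous_poisson_slab.
by apply: cvgB; [exact: cvg_cst|exact: cvg_id].
Qed.

Lemma poisson_slab_le1 e n s : 0 < e -> `|poisson_slab e n s| <= 1.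
Proof.
move=> e0; have pi0 := pi_gt0 R.
elim: n s => [|n IH] s.
  rewrite poisson_slab0// normf_div (gtr0_norm pi0) ler_pdivrMr// mul1r ler_norml.
  have := atan_ltpi2 ((2 * s + 1) / e); have := atan_gtNpi2 ((2 * s + 1) / e).
  have := atan_ltpi2 ((2 * s - 1) / e); have := atan_gtNpi2 ((2 * s - 1) / e).
  by move: (atan _) (atan _) pi0; move: pi => p a b *; apply/andP; split; lra.
have iU : mu.-integrable window (EFin \o (fun z => poisson_slab e n (s - z))).
  by apply: (@integrable_le _ _ _ (cst 1)) => //; exact: measurable_poisson_slabB.
rewrite poisson_slabS//; apply: (le_trans (le_normr_Rintegral _ iU)) => //.
apply: (@le_trans _ _ (\int[mu]_(z in window) 1)); last first.
  by rewrite Rintegral_cst// [X in fine X]muW mul1r.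
apply: le_Rintegral => //.
exact: integrable_norm.
Qed.

Let eps (k : nat) : R := k.+1%:R^-1.
Let eps_gt0 k : 0 < eps k. Proof. by rewrite invr_gt0. Qed.

Lemma cvg_atan_scale (c : R) : 0 < c -> atan (c / eps k) @[k --> \oo] --> pi / 2.
Proof.
move=> c0.
have hn : (k.+1%:R : R) @[k --> \oo] --> +oo.
  rewrite (cvg_shiftS (fun n : nat => n%:R : R)).
  exact: cvgr_idn.
have h := @gt0_cvgMry _ (k.+1%:R @[k --> \oo]) _ c id c0 hn.
have fF : Filter ((k.+1%:R : R) @[k --> \oo]) by exact _.
have := cvg_comp _ _ (h fF) (@cvgy_atan R).
apply: cvg_trans.
by apply: near_eq_cvg; apply: nearW => k /=; rewrite /eps invrK.
Qed.

Lemma cvg_atan_scaleN (c : R) : c < 0 -> atan (c / eps k) @[k --> \oo] --> - (pi / 2).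
Proof.
move=> c0; have h := @cvg_atan_scale (- c); rewrite oppr_gt0 in h.
have H := cvgN (h c0).
have -> : (fun k => atan (c / eps k)) = - (fun k => atan (- c / eps k)).
  by apply/funext => k; rewrite fctE mulNr atanN opprK.
exact: H.
Qed.

(** As e tends to 0 the differences of arctangents tend to the indicator of
    the window, except at its two ends; these form a null set, so after one averaging the
    convergence holds everywhere, and dominated convergence propagates it. *)
Lemma cvg_poisson_slab n s : (n = 0%N -> `|s| != 2^-1) ->
  poisson_slab (eps k) n s @[k --> \oo] --> slab_volume n s.
Proof.
elim: n s => [|n IH] s hs.
  have pi0 : pi != 0 :> R by rewrite gt_eqF// pi_gt0.
  suff [a [b [ha hb hab]]] : exists a b : R,
      [/\ atan ((2 * s + 1) / eps k) @[k --> \oo] --> a,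
      atan ((2 * s - 1) / eps k) @[k --> \oo] --> b &
      (a - b) / pi = slab_volume 0 s].
    rewrite -hab; under eq_fun do rewrite poisson_slab0//.
    by apply: cvgM; [exact: cvgB|exact: cvg_cst].
  have {hs} := hs erefl; rewrite slab_volume0.
  have [s0|s0|//] := ltgtP (`|s|) 2^-1 => _.
    move: s0; rewrite ltr_norml => /andP[s1 s2].
    exists (pi / 2), (- (pi / 2)); split.
    - by apply: cvg_atan_scale; lra.
    - by apply: cvg_atan_scaleN; lra.
    - by move: pi pi0 => p p0; field.
  have [s1|s1] := leP 0 s.
    rewrite ger0_norm// in s0.
    exists (pi / 2), (pi / 2); split.
    - by apply: cvg_atan_scale; lra.
    - by apply: cvg_atan_scale; lra.
    - by rewrite subrr mul0r.
  rewrite ltr0_norm// in s0.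
  exists (- (pi / 2)), (- (pi / 2)); split.
  - by apply: cvg_atan_scaleN; lra.
  - by apply: cvg_atan_scaleN; lra.
  - by rewrite subrr mul0r.
rewrite slab_volumeS.
under eq_fun do rewrite poisson_slabS//.
apply: (@Rdominated_cvg _ _ _ _ (cst 1)) => //.
- by move=> k; exact: measurable_poisson_slabB.
- exact: measurable_slab_volumeB.
- (* the z for which s - z is an end of the window *)
  have mN : mu.-negligible [set s - 2^-1; s + 2^-1].
    apply/negligibleP; first exact: measurableU.
    apply/eqP; rewrite -measure_le0; apply: (le_trans (measureU2 _ _ _)) => //.
    rewrite [X in (X + _ <= _)%E]lebesgue_measure_set1.
    by rewrite [X in (_ + X <= _)%E]lebesgue_measure_set1 adde0.
  move: mN => [N [mN N0 subN]]; exists N; split => // z /= hz; apply: subN => /=.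
  apply: contrapT => /not_orP[z1 z2]; apply: hz => _; apply: IH => _.
  apply/negP => /eqP.
  have [sz|sz] := leP 0 (s - z).
    by rewrite ger0_norm// => h; apply: z1; lra.
  by rewrite ltr0_norm// => h; apply: z2; lra.
- by move=> k z _; rewrite poisson_slab_le1.
Qed.

Lemma integrable_sincX n : (1 < n)%N ->
  mu.-integrable halfline (EFin \o (fun x => (sin x / x) ^+ n)).
Proof.
move=> n1; apply: (@integrable_decay _ _ 2); last by move=> x; exact: sincX_decay.
by apply: measurable_funX; exact: measurable_sinc.
Qed.

(** Fourier inversion for the density of a sum of at least two uniform variables.
    The regularised transform converges to the slab volume as e tends to 0, and also to the
    unregularised one, (sin x / x)^(n + 2) being integrable. *)
Lemma slab_volume_cosint n s :
  slab_volume n.+1 s = 2 / pi * cosint (fun x => (sin x / x) ^+ n.+2) s.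
Proof.
have h1 : poisson_slab (eps k) n.+1 s @[k --> \oo] --> slab_volume n.+1 s.
  exact: cvg_poisson_slab.
apply: (cvg_unique _ h1); first exact: norm_hausdorff.
apply: cvgM; first exact: cvg_cst.
have mc := @measurable_cos_lin R halfline s.
have ms : measurable_fun halfline (fun x : R => (sin x / x) ^+ n.+2).
  by apply: measurable_funX; exact: measurable_sinc.
apply: (@Rdominated_cvg _ _ _ _ (fun x => `|(sin x / x) ^+ n.+2|)) => //.
- move=> k; apply: measurable_funM => //; apply: measurable_funM => //.
  exact: measurable_poisson_weight.
- exact: measurable_funM.
- apply: aeW => x _; rewrite -[X in _ --> X]mul1r.
  under eq_fun do rewrite -mulrA.
  apply: cvgM; last exact: cvg_cst.
  rewrite -expR0 /poisson_weight.
  apply: (@continuous_cvg _ _ _ _ _ _ expR); first exact: continuous_expR.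
  rewrite -oppr0; apply: cvgN; rewrite -(mul0r x); apply: cvgM; last exact: cvg_cst.
  exact: cvg_harmonic.
- exact/integrable_norm/integrable_sincX.
- move=> k x /=; rewrite in_itv/= andbT => x0.
  rewrite !normrM -mulrA mulrCA ler_piMr//.
  rewrite mulr_ile1// ?ler_norml ?cos_geN1 ?cos_le1//.
  rewrite (le_trans _ (expR_ge0 _)) ?lerN10//=.
  by rewrite -expR0 ler_expR oppr_le0 mulr_ge0// ltW.
Qed.
End InversionLimit.

(** * The asymptotic expansion *)

Section Asymptotics.
Context {R : realType}.
Notation mu := (@lebesgue_measure R).
Notation halfline := (`]0, +oo[%classic : set R).
Implicit Types (x s t : R) (d : nat).

Let mH : measurable halfline. Proof. by []. Qed.

Lemma integrable_corrected_gauss d : (0 < d)%N ->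
  mu.-integrable halfline (EFin \o corrected_gauss d).
Proof.
move=> d0; have a0 : 0 < d%:R / 6 :> R by rewrite divr_gt0// ltr0n.
have i0 := @integrable_gauss_cos R 0 _ 0 a0 isT.
have i4 := @integrable_gauss_cos R 4 _ 0 a0 isT.
have := RintegrableB mH i0 (RintegrableZl (d%:R / 180) mH i4).
congr (mu.-integrable _ (EFin \o _)); apply/funext => x.
rewrite mul0r cos0 /corrected_gauss (_ : d%:R * x ^+ 2 / 6 = d%:R / 6 * x ^+ 2); last by field.
by field.
Qed.

Definition section_approx d t : R :=
  Num.sqrt (6 / pi) * expR (- 6 * t ^+ 2) *
  (1 - (3 - 72 * t ^+ 2 + 144 * t ^+ 4) / (20 * d%:R)).

(** The transform of the corrected Gaussian is the announced approximation:
    gauss_cos0 and gauss_cos4 with a = d / 6 and w = 2 t sqrt d. *)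
Lemma cosint_corrected_gauss d t : (0 < d)%N ->
  Num.sqrt d%:R * (2 / pi * cosint (corrected_gauss d) (Num.sqrt d%:R * t)) = section_approx d t.
Proof.
move=> d0; have D0 : 0 < d%:R :> R by rewrite ltr0n.
have pi0 := pi_gt0 R.
have a0 : 0 < d%:R / 6 :> R by rewrite divr_gt0.
set q := Num.sqrt d%:R; have q0 : 0 < q by rewrite sqrtr_gt0.
have qq : q ^+ 2 = d%:R by rewrite sqr_sqrtr// ltW.
set w := 2 * (q * t).
have i0 := @integrable_gauss_cos R 0 _ w a0 isT.
have i4 := @integrable_gauss_cos R 4 _ w a0 isT.
have -> : cosint (corrected_gauss d) (q * t) =
    gauss_cos 0 (d%:R / 6) w - d%:R / 180 * gauss_cos 4 (d%:R / 6) w.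
  rewrite /gauss_cos -RintegralZl// -RintegralB//; last exact: RintegrableZl.
  apply: eq_Rintegral => x _; rewrite /corrected_gauss.
  rewrite (_ : d%:R * x ^+ 2 / 6 = d%:R / 6 * x ^+ 2); last by field.
  rewrite (_ : 2 * x * (q * t) = w * x); last by rewrite /w; ring.
  by field.
rewrite gauss_cos4// gauss_cos0//.
have -> : w ^+ 2 / (4 * (d%:R / 6)) = 6 * t ^+ 2.
  by rewrite /w -qq; field; rewrite gt_eqF.
rewrite /section_approx mulNr.
have -> : Num.sqrt (pi / (d%:R / 6)) = Num.sqrt (6 / pi) * pi / q.
  have -> : pi / (d%:R / 6) = (6 / pi) * (pi ^+ 2 / d%:R) :> R.
    by move: pi pi0 => p p0; field; rewrite !gt_eqF.
  rewrite sqrtrM ?divr_ge0// ?ltW// -mulrA; congr (_ * _).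
  by rewrite sqrtrM ?sqr_ge0// sqrtr_sqr gtr0_norm// sqrtrV// ltW.
rewrite /w -qq; move: (Num.sqrt (6 / pi)) (expR _) => A B.
by move: pi pi0 => p p0; field; rewrite !gt_eqF.
Qed.

Definition error_const : R := near_const * Num.sqrt (32 * pi) / pi + far_const.

(** Integrate the pointwise estimate of (sin x / x)^d. The Gaussian term
    contributes d^-2 d^(-1/2) and the tail term d^-3, and the factor sqrt d turns
    the total into O(d^-2), uniformly in t. *)
Lemma section_volume_error d t : (3 < d)%N ->
  `|Num.sqrt d%:R * slab_volume d.-1 (Num.sqrt d%:R * t) - section_approx d t| <=
  error_const / (d%:R ^+ 2).
Proof.
move=> d4; have d0 : (0 < d)%N by exact: leq_trans d4.
have D0 : 0 < d%:R :> R by rewrite ltr0n.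
have D1 : 1 <= d%:R :> R by rewrite ler1n.
have pi0 := pi_gt0 R.
set q := Num.sqrt d%:R; have q0 : 0 < q by rewrite sqrtr_gt0.
have qq : q ^+ 2 = d%:R by rewrite sqr_sqrtr// ltW.
have -> : slab_volume d.-1 (q * t) = 2 / pi * cosint (fun x => (sin x / x) ^+ d) (q * t).
  by case: d d4 {d0 D0 D1 q0 qq} @q => [|[|d]]// _ q; exact: slab_volume_cosint.
rewrite -cosint_corrected_gauss// -/q -mulrBr -mulrBr.
have p0 : 0 < 2 / pi :> R by rewrite divr_gt0.
rewrite normrM (gtr0_norm q0) normrM (gtr0_norm p0); set s := q * t.
have i1 := @integrable_sincX R d (leq_trans (isT : (2 <= 4)%N) d4).
have i2 := integrable_corrected_gauss d0.
have c1 := integrable_cosint s i1; have c2 := integrable_cosint s i2.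
have a0 : 0 < d%:R / 32 :> R by rewrite divr_gt0.
have g0 := @integrable_gauss_cos R 0 _ 0 a0 isT.
pose G x : R := near_const / d%:R ^+ 2 * (x ^+ 0 * expR (- (d%:R / 32 * x ^+ 2)) * cos (0 * x)) +
  far_const / d%:R ^+ 3 * (1 + x ^+ 2)^-1.
have iO : mu.-integrable halfline (EFin \o (fun x : R => (1 + x ^+ 2)^-1)).
  exact: integrable_oneDsqrV.
have iG1 := RintegrableZl (near_const / d%:R ^+ 2) mH g0.
have iG2 := RintegrableZl (far_const / d%:R ^+ 3) mH iO.
have iG : mu.-integrable halfline (EFin \o G) by exact: RintegrableD mH iG1 iG2.
have bound : `|cosint (fun x => (sin x / x) ^+ d) s - cosint (corrected_gauss d) s| <=
    \int[mu]_(x in halfline) G x.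
  rewrite /cosint -RintegralB//.
  have i12 := RintegrableB mH c1 c2.
  apply: (le_trans (le_normr_Rintegral _ i12)) => //.
  apply: le_Rintegral => //; first exact: integrable_norm.
  move=> x /=; rewrite in_itv/= andbT => x0.
  rewrite -mulrBl normrM /G.
  apply: (@le_trans _ _ `|(sin x / x) ^+ d - corrected_gauss d x|).
    by rewrite ler_piMr// ler_norml cos_geN1 cos_le1.
  have := @sinc_pow_gauss R d x d4 x0.
  by rewrite mul0r cos0 mulr1 expr0 mul1r (_ : d%:R / 32 * x ^+ 2 = d%:R * x ^+ 2 / 32)//; field.
have GE : \int[mu]_(x in halfline) G x =
    near_const / d%:R ^+ 2 * (Num.sqrt (32 * pi) / q / 2) + far_const / d%:R ^+ 3 * (pi / 2).
  rewrite RintegralD// !RintegralZl//.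
  have -> : \int[mu]_(x in halfline) (1 + x ^+ 2)^-1 = pi / 2.
    rewrite /Rintegral integral_itv_obnd_cbnd ?integral0y_oneDsqr//.
    by have /measurable_int := iO.
  have := @gauss_cos00 R _ a0; rewrite /gauss_cos => ->.
  rewrite (_ : pi / (d%:R / 32) = (32 * pi) / d%:R); last by field; rewrite gt_eqF.
  by rewrite sqrtrM ?mulr_ge0 ?ltW// sqrtrV// ltW.
apply: (@le_trans _ _ (q * (2 / pi * \int[mu]_(x in halfline) G x))).
  by rewrite ler_wpM2l ?(ltW q0)// ler_wpM2l// divr_ge0// ltW.
have nc0 : 0 <= near_const :> R by rewrite /near_const addr_ge0.
have fc0 : 0 <= far_const :> R by rewrite /far_const mulr_ge0// exprn_ge0// divr_ge0.
have q1 : q <= d%:R.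
  have : 1 <= q by rewrite -sqrtr1 ler_wsqrtr.
  by rewrite -qq expr2 => ?; rewrite ler_peMl// ltW.
rewrite GE /error_const (_ : q * _ =
  (near_const * Num.sqrt (32 * pi) / pi + far_const * (q / d%:R)) / d%:R ^+ 2); last first.
  by move: (Num.sqrt (32 * pi)) => A; move: pi pi0 => p pp; rewrite -qq; field; rewrite !gt_eqF.
by rewrite ler_pM2r ?invr_gt0 ?exprn_gt0// lerD2l ler_piMr// ler_pdivrMr// mul1r.
Qed.

Lemma powR32 d : (d%:R : R) `^ (3 / 2) = d%:R * Num.sqrt d%:R.
Proof.
rewrite (_ : 3 / 2 = 1 + 2^-1); last by field.
have p0 : 0 < 1 + 2^-1 :> R by lra.
rewrite powRD; last by rewrite gt_eqF.
by rewrite powRr1// powR12_sqrt.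
Qed.
End Asymptotics.

Theorem theorem1p5 (R : realType) :
  exists N : nat, forall (d : nat) (t : R) (H : set 'rV[R]_d),
    (0 < d)%N -> (N <= d)%N -> 0 <= t ->
    orthogonal_to_diagonal H -> eucl_dist (cube_center d) H = t ->
    (`| flat_volume d.-1 (H `&` cube d)
        - (Num.sqrt (6 / pi) * expR (- 6 * t ^+ 2) *
           (1 - (3 - 72 * t ^+ 2 + 144 * t ^+ 4) / (20 * d%:R)))%:E |
      < ((d%:R `^ (3 / 2))^-1)%:E)%E.
Proof.
(* beyond the square of error_const, error_const / d^2 is less than sqrt d / d^2 *)
exists (Num.bound (error_const ^+ 2 : R)).+4 => d t H _ dN t0.
have d4 : (3 < d)%N by exact: leq_trans dN.
have [n dE] : exists n, d = n.+2 by exists (d - 2)%N; rewrite -addn2 subnK// (ltn_trans _ d4).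
move: H; rewrite {}dE in dN d4 *; set D := n.+2 in dN d4 * => H diagH distH.
rewrite (flat_volume_diagonal_section diagH distH) -EFinB abse_EFin lte_fin.
have D0 : 0 < D%:R :> R by rewrite ltr0n.
apply: (le_lt_trans (section_volume_error t d4)).
rewrite powR32; set q := Num.sqrt D%:R.
have q0 : 0 < q by rewrite sqrtr_gt0.
have qq : q ^+ 2 = D%:R by rewrite sqr_sqrtr// ltW.
rewrite ltr_pdivrMr ?exprn_gt0// mulrC.
rewrite (_ : D%:R ^+ 2 * _ = q); last by rewrite -qq; field; rewrite gt_eqF.
apply: (le_lt_trans (ler_norm _)); rewrite -sqrtr_sqr ltr_sqrt//.
apply: (@lt_trans _ _ (Num.bound (error_const ^+ 2 : R))%:R).
  by apply: archi_boundP; exact: sqr_ge0.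
by rewrite ltr_nat; apply: leq_trans dN; do 3 apply: leqW.
Qed.
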